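(* Let $A$ be a Banach algebra with a bounded approximate identity and an $F\ell^1(\eta)$-base $\mathscr L$ (of type 1, 2 or 3) for some infinite cardinal $\eta$ and some integer $m\in\mathbb N$ ($m=1$ for types 1 and 2). Let $X=\bigcup_{k=1}^mX_k\subseteq LUC(A)^*$ with $X_k=\{\Psi_{pk}:p\in\mathscr C(\eta)\}$, and let $\widetilde X\subseteq A^{**}$ consist of one fixed norm-preserving extension to $A^*$ of each element of $X$. Let $\mathscr S$ be any non-trivial subalgebra of $LUC(A)^*$ with $X\subseteq\mathscr S$, or any non-trivial subalgebra of $A^{**}$ with $\widetilde X\subseteq\mathscr S$. Then the dimension of any principal right ideal $\Psi\mathscr S$ ($0\ne\Psi\in\mathscr S$), and so of any nonzero right ideal, in $\mathscr S$ is at least $2^{2^\eta}$.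
   Context: Dimension means vector space dimension. Products. $\langle S\cdot a,b\rangle=\langle S,ab\rangle$ for $S\in A^*$, $a,b\in A$. $LUC(A)$ is the closed linear span of $\{S\cdot a\}$ in $A^*$. For $\Psi$ in $A^{**}$ or $LUC(A)^*$, $\langle\Psi\cdot S,a\rangle=\langle\Psi,S\cdot a\rangle$. $A^{**}$ and $LUC(A)^*$ carry the first Arens product $\langle\Phi\Psi,S\rangle=\langle\Phi,\Psi\cdot S\rangle$ ($S\in A^*$, resp. $S\in LUC(A)$). Right multipliers. $M_r(A)$ is the algebra of bounded operators $R$ on $A$ with $R(ab)=aR(b)$, with product $R_1R_2=R_2\circ R_1$; $A$ sits in $M_r(A)$ by right multiplications, and $aR=R(a)\in A$ for $a\in A$. With a bai $(e_i)$, $R\in M_r(A)$ is viewed in $LUC(A)^*$ as the weak$^*$-limit of $(R(e_i))$, i.e. $\langle R,S\cdot a\rangle=\langle S,aR\rangle$. $\langle E\rangle$ denotes linear span; cardinals are identified with initial ordinals. $\ell^1(\eta)$-base: a bounded set, indexed by a set of cardinality $\eta$, for which there is $K>0$ with $\sum_{n=1}^p|z_n|\le K\|\sum_{n=1}^pz_nx_n\|$ for all $p$, scalars $z_n$ and distinct elements $x_1,\dots,x_p$ of the set. $\ell^1(\eta)$-selective base with constant $K_1>0$: a bounded set $\mathscr L=\bigcup_{\alpha<\eta}\mathscr L_\alpha$, $\mathscr L_\alpha\neq\emptyset$, such that the spans $\langle\mathscr L_\alpha\rangle$ have zero pairwise intersections and $\sum_{n=1}^p\|x_n\|\le K_1\|\sum_{n=1}^px_n\|$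 whenever $x_n\in\langle\mathscr L_{\alpha_n}\rangle$ with $\alpha_1,\dots,\alpha_p$ distinct. Zooming set in $A$: a set $\bigcup_{\alpha<\eta}A_\alpha a_\alpha$ where (i) $\{A_\alpha\}_{\alpha<\eta}$ is an increasing family of subsets of $A$ with $A_\eta=\bigcup_{\alpha<\eta}A_\alpha$ bounded (by $1$, say) and of closed linear span $A$; (ii) $\{a_\alpha:\alpha<\eta\}$ is bounded in $M_r(A)$; (iii) the spans $\langle A_\alpha a_\alpha\rangle$ have zero pairwise intersections. $F\ell^1(\eta)$-base of type 1: a zooming set that is an $\ell^1(\eta)$-base, the elements $aa_\alpha$ being indexed by the pairs $(\alpha,a)$, $a\in A_\alpha$. Type 2: a zooming set that is an $\ell^1(\eta)$-selective base (with $\mathscr L_\alpha=A_\alpha a_\alpha$) such that for some $K_2>0$, $\|a\|\le K_2\|aa_\alpha\|$ for all $a\in\langle A_\alpha\rangle$, $\alpha<\eta$. Type 3: a set $\bigcup_{\alpha<\eta}A_\alpha\{a_\alpha^k:k=1,\dots,m\}$ which is an $\ell^1(\eta)$-selective base with $\mathscr L_\alpha=\bigcup_{k=1}^mA_\alpha a_\alpha^k$, where $\{A_\alpha\}$ is as in (i), $\{\mathbf a_\alpha=(a_\alpha^k)_{k=1}^m\}$ is bounded in $M_r(A)^m$, for each $k$ the spans $\langle A_\alpha a_\alpha^k\rangle$ have zero pairwise intersections, and for some $K_2>0$, $\|a\|\le K_2\|(aa_\alpha^k)_{k=1}^m\|$ for all $a\in\langle A_\alpha\rangle$, $\alpha<\eta$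 (any $p$-norm on $A^m$). For types 1 and 2 put $m=1$, $a_\alpha^1=a_\alpha$. Cluster points. $\mathscr C(\eta)$ is the set of cofinal ultrafilters on $\eta$ (all members cofinal in $\eta$). For $p\in\mathscr C(\eta)$, $\Psi_{pk}\in LUC(A)^*$ is the weak$^*$-limit along $p$ of $\alpha\mapsto a_\alpha^k\in M_r(A)\subseteq LUC(A)^*$. *)

(* Defs.v *)
From HB Require Import structures.
From mathcomp Require Import all_boot all_order all_algebra.
From mathcomp Require Import complex.
From mathcomp Require Import all_classical all_reals topology normedtype.

Set Implicit Arguments.
Unset Strict Implicit.
Unset Printing Implicit Defensive.

Import Order.TTheory GRing.Theory Num.Theory.
Import numFieldNormedType.Exports.

Local Open Scope classical_set_scope.
Local Open Scope card_scope.
Local Open Scope ring_scope.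
Local Open Scope complex_scope.

Section Span.
Variables (K : fieldType) (V : lmodType K).
Implicit Types (E W B : set V).

Definition lspan E : set V :=
  [set x | exists n (c : 'I_n -> K) (v : 'I_n -> V),
     (forall i, E (v i)) /\ x = \sum_(i < n) c i *: v i].

Definition lin_indep B : Prop :=
  forall n (c : 'I_n -> K) (v : 'I_n -> V),
    injective v -> (forall i, B (v i)) ->
    \sum_(i < n) c i *: v i = 0 -> forall i, c i = 0.

Definition hamel_basis W B : Prop := lin_indep B /\ lspan B = W.

(* dim W >= card T; all Hamel bases of [W] are equipotent. *)
Definition dim_ge W (T : Type) : Prop :=
  exists2 B, hamel_basis W B & [set: T] #<= B.

Definition subspace_closed W : Prop :=
  W 0 /\ forall (c : K) x y, W x -> W y -> W (c *: x + y).

Lemma lspan_sub E : E `<=` lspan E.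
Proof.
move=> x Ex; exists 1%N, (fun=> 1), (fun=> x); split=> //.
by rewrite big_ord1 scale1r.
Qed.

Lemma lspan_subspace E : subspace_closed (lspan E).
Proof.
split; first by exists 0%N, (fun=> 0), (fun=> 0); rewrite big_ord0; split=> [[]|].
move=> c x y [n [a [v [Ev ->]]]] [m [b [w [Ew ->]]]].
exists (n + m)%N,
  (fun i : 'I_(n + m) => match fintype.split i with inl j => c * a j | inr j => b j end),
  (fun i : 'I_(n + m) => match fintype.split i with inl j => v j | inr j => w j end).
split=> [i|]; first by case: (fintype.split i).
rewrite big_split_ord scaler_sumr /=; congr (_ + _); apply: eq_bigr => i _.
  by rewrite (unsplitK (inl i)) scalerA.
by rewrite (unsplitK (inr i)).
Qed.

Lemma lspan_min E W : subspace_closed W -> E `<=` W -> lspan E `<=` W.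
Proof.
move=> [W0 WD] EW x [n [c [v [Ev ->]]]].
elim: n c v Ev => [|n IH] c v Ev; first by rewrite big_ord0.
rewrite big_ord_recl; apply: WD; first exact/EW/Ev.
by apply: IH => i; exact: Ev.
Qed.

End Span.

Lemma closure_normP (R : realType) (V : normedModType R[i]) (E : set V) x :
  closure E x <-> forall eps : R[i], 0 < eps -> exists2 y, E y & `|x - y| < eps.
Proof.
split=> [cE eps e0|H U /nbhs_ballP[eps /= e0 HU]].
  by have [y [Ey]] := cE _ (nbhsx_ballx x _ e0); rewrite -ball_normE /=; exists y.
have [y Ey xy] := H _ e0; exists y; split=> //; apply: HU.
by rewrite -ball_normE.
Qed.

Lemma closure_subspace (R : realType) (V : normedModType R[i]) (E : set V) :
  subspace_closed E -> subspace_closed (closure E).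
Proof.
move=> [E0 ED]; split; first exact: subset_closure.
move=> c x y /closure_normP cx /closure_normP cy.
apply/closure_normP => eps e0.
have e2 : 0 < eps / 2 by rewrite divr_gt0.
have c1 : 0 < `|c| + 1 by rewrite ltr_wpDl.
have [x' Ex' xx'] := cx _ (divr_gt0 e2 c1).
have [y' Ey' yy'] := cy _ e2.
exists (c *: x' + y'); first exact: ED.
rewrite opprD addrACA -scalerBr (le_lt_trans (ler_normD _ _))//.
rewrite [ltRHS]splitr ler_ltD// normrZ.
rewrite (@le_trans _ _ (`|c| * (eps / 2 / (`|c| + 1))))//.
  by rewrite ler_wpM2l// ltW.
rewrite mulrCA ger_pMr// ler_pdivrMr// mul1r.
by rewrite lerDl.
Qed.

(* The norm of an [R[i]]-module is [R[i]]-valued; this is the same norm in [R]. *)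
Definition rnorm (R : realType) (V : normedModType R[i]) (x : V) : R :=
  complex.Re `|x|.

Lemma rnormE (R : realType) (V : normedModType R[i]) (x : V) :
  (rnorm x)%:C = `|x|.
Proof. by rewrite RRe_real ?normr_real. Qed.

Lemma rnorm_ge0 (R : realType) (V : normedModType R[i]) (x : V) : 0 <= rnorm x.
Proof. by rewrite -ler0c rnormE. Qed.

Lemma realcD (R : realType) (x y : R) : (x + y)%:C = x%:C + y%:C.
Proof. exact: rmorphD. Qed.

Lemma realcM (R : realType) (x y : R) : (x * y)%:C = x%:C * y%:C.
Proof. exact: rmorphM. Qed.

Section Dual.
Variables (R : realType) (V : normedModType R[i]).

Definition bounded_functional (f : V -> R[i]^o) : Prop :=
  linear f /\ exists M : R, forall x, `|f x| <= M%:C * `|x|.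

Definition dual_pred : {pred V -> R[i]^o} :=
  mem [set f | bounded_functional f].

Record dual := Dual { dualfun :> V -> R[i]^o; _ : dualfun \in dual_pred }.

HB.instance Definition _ := [isSub for dualfun].
HB.instance Definition _ := gen_eqMixin dual.
HB.instance Definition _ := gen_choiceMixin dual.

Lemma dual_subproof : GRing.submod_closed dual_pred.
Proof.
split=> [|c f g].
  apply/mem_set; split=> [a x y|]; first by rewrite /= /GRing.zero/= scaler0 addr0.
  by exists 0 => x; rewrite normr0 mul0r.
move=> /set_mem[lf [M HM]] /set_mem[lg [N HN]]; apply/mem_set; split.
  move=> a x y.
  rewrite -[LHS]/(c *: f (a *: x + y) + g (a *: x + y)).
  rewrite -[RHS]/(a *: (c *: f x + g x) + (c *: f y + g y)) lf lg.
  by rewrite !scalerDr !scalerA addrACA [c * a]mulrC.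
exists (rnorm (c : R[i]^o) * M + N) => x.
rewrite (le_trans (ler_normD _ _))// realcD realcM mulrDl lerD//.
by rewrite [leLHS]normrZ rnormE -mulrA ler_wpM2l.
Qed.

HB.instance Definition _ :=
  GRing.isSubmodClosed.Build _ _ dual_pred dual_subproof.
HB.instance Definition _ := [SubChoice_isSubLmodule of dual by <:].

Lemma dual_bounded_functional (f : dual) : bounded_functional f.
Proof. by case: f => f fP; exact: set_mem fP. Qed.

Lemma dual_linear (f : dual) : linear f.
Proof. by case: (dual_bounded_functional f). Qed.

HB.instance Definition _ (f : dual) :=
  GRing.isLinear.Build _ _ _ _ (dualfun f) (dual_linear f).

Lemma dualP (f g : dual) : f =1 g -> f = g.
Proof. by move=> fg; apply/val_inj/funext. Qed.

Definition dual_norm (f : dual) : R :=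
  sup [set rnorm (f x) | x in [set x : V | `|x| <= 1]].

Lemma dual_has_sup (f : dual) :
  has_sup [set rnorm (f x) | x in [set x : V | `|x| <= 1]].
Proof.
split; first by exists (rnorm (f 0)), 0 => //=; rewrite normr0.
have [_ [M HM]] := dual_bounded_functional f.
exists `|M| => _ [x /= x1 <-].
rewrite -lecR rnormE (le_trans (HM x))//.
rewrite (@le_trans _ _ (`|M|%:C * `|x|))//.
  by rewrite ler_wpM2r// lecR ler_norm.
by rewrite ler_piMr// lecR.
Qed.

Lemma dual_norm_ge0 f : 0 <= dual_norm f.
Proof.
apply: (@le_trans _ _ (rnorm (f 0))).
  exact: rnorm_ge0.
by apply: sup_upper_bound; [exact: dual_has_sup|exists 0 => //=; rewrite normr0].
Qed.

Lemma dual_norm_bound (f : dual) x : `|f x| <= (dual_norm f)%:C * `|x|.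
Proof.
have [->|x0] := eqVneq x 0; first by rewrite linear0 !normr0 mulr0.
have nx : 0 < `|x| by rewrite normr_gt0.
have : rnorm (f (`|x|^-1 *: x)) <= dual_norm f.
  apply: sup_upper_bound; first exact: dual_has_sup.
  exists (`|x|^-1 *: x) => //.
  by rewrite /mkset normrZ normfV normr_id mulVf// gt_eqF.
rewrite -lecR rnormE linearZ [in leLHS]normrZ normfV normr_id.
by rewrite ler_pdivrMl// mulrC.
Qed.

Lemma dual_norm_le (f : dual) (M : R) :
  0 <= M -> (forall x, `|f x| <= M%:C * `|x|) -> dual_norm f <= M.
Proof.
move=> M0 HM; apply: ge_sup; first by case: (dual_has_sup f).
move=> _ [x /= x1 <-]; rewrite -lecR rnormE (le_trans (HM x))//.
by rewrite ler_piMr// lecR.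
Qed.

Let norm (f : dual) : R[i] := (dual_norm f)%:C.

Lemma dual_ler_normD f g : norm (f + g) <= norm f + norm g.
Proof.
rewrite /norm -realcD lecR; apply: dual_norm_le => [|x].
  by rewrite addr_ge0// dual_norm_ge0.
rewrite (le_trans (ler_normD _ _))// realcD mulrDl.
by apply: lerD; exact: dual_norm_bound.
Qed.

Lemma dual_normrZ_le (c : R[i]) f : norm (c *: f) <= `|c| * norm f.
Proof.
rewrite /norm -(rnormE (c : R[i]^o)) -realcM lecR.
apply: dual_norm_le => [|x].
  by rewrite mulr_ge0 ?dual_norm_ge0 ?rnorm_ge0.
rewrite -[(c *: f) x]/(c *: f x) normrZ realcM rnormE -mulrA.
by rewrite ler_wpM2l// dual_norm_bound.
Qed.

Lemma dual_normrZ (c : R[i]) f : norm (c *: f) = `|c| * norm f.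
Proof.
apply/eqP; rewrite eq_le dual_normrZ_le/=.
have [->|c0] := eqVneq c 0; first by rewrite normr0 mul0r lecR dual_norm_ge0.
rewrite -ler_pdivlMl ?normr_gt0// -normfV.
by rewrite -{1}[f]scale1r -(mulVf c0) -scalerA dual_normrZ_le.
Qed.

Lemma dual_normr0_eq0 f : norm f = 0 -> f = 0.
Proof.
move=> f0; apply: dualP => x; apply/eqP; rewrite -normr_le0.
by rewrite (le_trans (dual_norm_bound f x))// -/(norm f) f0 mul0r.
Qed.

HB.instance Definition _ := Lmodule_isNormed.Build R[i] dual
  dual_ler_normD dual_normrZ dual_normr0_eq0.

Lemma dual_normE f : `|f| = (dual_norm f)%:C. Proof. by []. Qed.

End Dual.

Section MkDual.
Variables (R : realType) (V : normedModType R[i]).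

Definition mk_dual (f : V -> R[i]^o) (bf : bounded_functional f) : dual V :=
  Dual (mem_set bf).

Lemma dualD (f g : dual V) x : (f + g) x = f x + g x. Proof. by []. Qed.

Lemma dualZ (c : R[i]) (f : dual V) x : (c *: f) x = c *: f x. Proof. by []. Qed.

Lemma dual_norm_mk (f : dual V) (M : R) :
  0 <= M -> (forall x, `|f x| <= M%:C * `|x|) -> `|f| <= M%:C.
Proof. by move=> M0 HM; rewrite dual_normE lecR; exact: dual_norm_le. Qed.

Lemma dual_bound (f : dual V) x : `|f x| <= `|f| * `|x|.
Proof. exact: dual_norm_bound. Qed.

End MkDual.

(* Not assumed to be unital, hence not a ring structure. *)

HB.mixin Record CompleteNormedModule_isBanachAlgebra (R : realType) A
    & CompleteNormedModule R[i] A := {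
  bmul : A -> A -> A;
  bmulA : associative bmul;
  bmul_linearl : forall b : A, linear (fun a => bmul a b);
  bmul_linearr : forall a : A, linear (fun b => bmul a b);
  ler_norm_bmul : forall a b : A, `|bmul a b| <= `|a| * `|b|
}.

#[short(type="banachAlgType")]
HB.structure Definition BanachAlgebra (R : realType) :=
  {A of CompleteNormedModule R[i] A & CompleteNormedModule_isBanachAlgebra R A}.

Notation "a ** b" := (bmul a b) (at level 40, left associativity).

Section ArensProducts.
Variables (R : realType) (A : banachAlgType R).
Implicit Types (S T : dual A) (a b : A).

(* <S . a, b> = <S, a b> *)
Lemma dact_subproof S a : bounded_functional (fun b => S (a ** b)).
Proof.
split=> [c x y|]; first by rewrite bmul_linearr linearP.
exists (rnorm S * rnorm a) => x; rewrite realcM !rnormE -mulrA.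
by rewrite (le_trans (dual_bound _ _))// ler_wpM2l// ler_norm_bmul.
Qed.
Definition dact S a : dual A := mk_dual (dact_subproof S a).

Lemma dactE S a b : dact S a b = S (a ** b). Proof. by []. Qed.

Lemma dact_norm S a : `|dact S a| <= `|S| * `|a|.
Proof.
rewrite -(rnormE S) -(rnormE a) -realcM; apply: dual_norm_mk => [|x].
  by rewrite mulr_ge0 ?rnorm_ge0.
rewrite realcM !rnormE dactE -mulrA.
by rewrite (le_trans (dual_bound _ _))// ler_wpM2l// ler_norm_bmul.
Qed.

Lemma dact_linearl a : linear (fun S => dact S a).
Proof. by move=> c S T; apply: dualP. Qed.

Lemma dact_linearr S : linear (dact S).
Proof.
move=> c a b; apply: dualP => x.
by rewrite dualD dualZ !dactE bmul_linearl linearP.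
Qed.

Definition luc_set : set (dual A) :=
  closure (lspan [set dact S a | S in [set: dual A] & a in [set: A]]).

Definition luc_pred : {pred dual A} := mem luc_set.

Lemma luc_subspace : subspace_closed luc_set.
Proof. exact/closure_subspace/lspan_subspace. Qed.

Lemma luc_subproof : GRing.submod_closed luc_pred.
Proof.
have [L0 LD] := luc_subspace; split=> [|c S T]; first exact: mem_set.
by move=> /set_mem LS /set_mem LT; exact/mem_set/LD.
Qed.

HB.instance Definition _ :=
  GRing.isSubmodClosed.Build _ _ luc_pred luc_subproof.

Record LUC := Luc { lucval :> dual A; _ : lucval \in luc_pred }.

HB.instance Definition _ := [isSub for lucval].
HB.instance Definition _ := gen_eqMixin LUC.
HB.instance Definition _ := gen_choiceMixin LUC.
HB.instance Definition _ := [SubChoice_isSubLmodule of LUC by <:].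

Lemma lucD (S T : LUC) : lucval (S + T) = lucval S + lucval T.
Proof. by []. Qed.

Lemma lucZ (c : R[i]) (S : LUC) : lucval (c *: S) = c *: lucval S.
Proof. by []. Qed.

Let luc_norm (S : LUC) : R[i] := `|lucval S|.

Lemma luc_ler_normD (S T : LUC) : luc_norm (S + T) <= luc_norm S + luc_norm T.
Proof. exact: ler_normD. Qed.

Lemma luc_normrZ (c : R[i]) (S : LUC) : luc_norm (c *: S) = `|c| * luc_norm S.
Proof. exact: normrZ. Qed.

Lemma luc_normr0_eq0 (S : LUC) : luc_norm S = 0 -> S = 0.
Proof. by move=> /normr0_eq0 S0; exact: val_inj. Qed.

HB.instance Definition _ := Lmodule_isNormed.Build R[i] LUC
  luc_ler_normD luc_normrZ luc_normr0_eq0.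

Lemma luc_normE (S : LUC) : `|S| = `|lucval S|. Proof. by []. Qed.

Lemma luc_inP (S : LUC) : luc_set S.
Proof. by case: S => S SL; exact: set_mem SL. Qed.

Definition mk_luc S (LS : luc_set S) : LUC := Luc (mem_set LS).

Lemma luc_act_subproof S a : luc_set (dact S a).
Proof.
have : lspan [set dact T b | T in [set: dual A] & b in [set: A]] (dact S a).
  by apply: lspan_sub; exists S => //; exists a.
exact: subset_closure.
Qed.
Definition luc_act S a : LUC := mk_luc (@luc_act_subproof S a).

(* <Psi . S, a> = <Psi, S . a>, for Psi in LUC(A)^* and S in A^* *)
Lemma luc_dual_act_subproof (Psi : dual LUC) S :
  bounded_functional (fun a => Psi (luc_act S a)).
Proof.
split=> [c a b|].
  rewrite -linearP; congr (Psi _); apply: val_inj.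
  exact: dact_linearr.
exists (rnorm Psi * rnorm S) => a; rewrite realcM !rnormE -mulrA.
by rewrite (le_trans (dual_bound _ _))// ler_wpM2l// dact_norm.
Qed.
Definition luc_dual_act (Psi : dual LUC) S : dual A :=
  mk_dual (luc_dual_act_subproof Psi S).

Lemma luc_dual_actE Psi S a : luc_dual_act Psi S a = Psi (luc_act S a).
Proof. by []. Qed.

Lemma luc_dual_act_norm Psi S : `|luc_dual_act Psi S| <= `|Psi| * `|S|.
Proof.
rewrite -(rnormE Psi) -(rnormE S) -realcM; apply: dual_norm_mk => [|a].
  by rewrite mulr_ge0 ?rnorm_ge0.
rewrite realcM !rnormE luc_dual_actE -mulrA.
by rewrite (le_trans (dual_bound _ _))// ler_wpM2l// dact_norm.
Qed.

Lemma luc_dual_act_linear Psi : linear (luc_dual_act Psi).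
Proof.
move=> c S T; apply: dualP => a.
rewrite dualD dualZ !luc_dual_actE -linearP; congr (Psi _).
by apply: val_inj; exact: dact_linearl.
Qed.

Lemma luc_dual_act_luc Psi S : luc_set S -> luc_set (luc_dual_act Psi S).
Proof.
have [L0 LD] := luc_subspace.
have step T : lspan [set dact U a | U in [set: dual A] & a in [set: A]] T ->
    luc_set (luc_dual_act Psi T).
  apply: (@lspan_min _ _ _ [set T | luc_set (luc_dual_act Psi T)]).
    split=> [|c U W /= LU LW]; last by rewrite luc_dual_act_linear; exact: LD.
    rewrite /= (_ : luc_dual_act _ _ = 0)//.
    by have := luc_dual_act_linear Psi (-1) 0 0; rewrite !scaleN1r oppr0 addr0 addNr.
  move=> _ [U _ [a _ <-]] /=.
  rewrite (_ : luc_dual_act _ _ = dact (luc_dual_act Psi U) a).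
    exact: (@luc_act_subproof).
  apply: dualP => b; rewrite dactE !luc_dual_actE; congr (Psi _).
  by apply/val_inj/dualP => x; rewrite /= bmulA.
move=> /closure_normP LS.
suff : closure luc_set (luc_dual_act Psi S) by exact: closed_closure.
apply/closure_normP => eps e0.
have P1 : 0 < `|Psi| + 1 by rewrite ltr_wpDl.
have [T /step LT ST] := LS _ (divr_gt0 e0 P1).
exists (luc_dual_act Psi T) => //.
rewrite -scaleN1r addrC -luc_dual_act_linear (le_lt_trans (luc_dual_act_norm _ _))//.
rewrite scaleN1r addrC.
rewrite (@le_lt_trans _ _ ((`|Psi| + 1) * `|S - T|))//.
  by rewrite ler_wpM2r// lerDl.
by rewrite mulrC -ltr_pdivlMr.
Qed.

Definition luc_dual_act_LUC Psi (S : LUC) : LUC :=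
  mk_luc (@luc_dual_act_luc Psi S (@luc_inP S)).

(* First Arens product of LUC(A)^* : <Phi Psi, S> = <Phi, Psi . S> *)
Lemma luc_arens_subproof (Phi Psi : dual LUC) :
  bounded_functional (fun S : LUC => Phi (luc_dual_act_LUC Psi S)).
Proof.
split=> [c S T|].
  rewrite -linearP; congr (Phi _); apply: val_inj.
  exact: luc_dual_act_linear.
exists (rnorm Phi * rnorm Psi) => S; rewrite realcM !rnormE -mulrA.
by rewrite (le_trans (dual_bound _ _))// ler_wpM2l// luc_dual_act_norm.
Qed.
Definition luc_arens (Phi Psi : dual LUC) : dual LUC :=
  mk_dual (luc_arens_subproof Phi Psi).

(* <Psi . S, a> = <Psi, S . a>, for Psi in A^** and S in A^* *)
Lemma bidual_act_subproof (Psi : dual (dual A)) S :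
  bounded_functional (fun a => Psi (dact S a)).
Proof.
split=> [c a b|]; first by rewrite dact_linearr linearP.
exists (rnorm Psi * rnorm S) => a; rewrite realcM !rnormE -mulrA.
by rewrite (le_trans (dual_bound _ _))// ler_wpM2l// dact_norm.
Qed.
Definition bidual_act (Psi : dual (dual A)) S : dual A :=
  mk_dual (bidual_act_subproof Psi S).

Lemma bidual_actE Psi S a : bidual_act Psi S a = Psi (dact S a).
Proof. by []. Qed.

Lemma bidual_act_norm Psi S : `|bidual_act Psi S| <= `|Psi| * `|S|.
Proof.
rewrite -(rnormE Psi) -(rnormE S) -realcM; apply: dual_norm_mk => [|a].
  by rewrite mulr_ge0 ?rnorm_ge0.
rewrite realcM !rnormE bidual_actE -mulrA.
by rewrite (le_trans (dual_bound _ _))// ler_wpM2l// dact_norm.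
Qed.

(* First Arens product of A^** : <Phi Psi, S> = <Phi, Psi . S> *)
Lemma bidual_arens_subproof (Phi Psi : dual (dual A)) :
  bounded_functional (fun S => Phi (bidual_act Psi S)).
Proof.
split=> [c S T|].
  rewrite -linearP; congr (Phi _); apply: dualP => a.
  rewrite dualD dualZ -[LHS]/(Psi (dact (c *: S + T) a)).
  by rewrite dact_linearl linearP.
exists (rnorm Phi * rnorm Psi) => S; rewrite realcM !rnormE -mulrA.
by rewrite (le_trans (dual_bound _ _))// ler_wpM2l// bidual_act_norm.
Qed.
Definition bidual_arens (Phi Psi : dual (dual A)) : dual (dual A) :=
  mk_dual (bidual_arens_subproof Phi Psi).

Lemma luc_eval_subproof a : bounded_functional (fun S : LUC => (S : dual A) a).
Proof.
split=> // ; exists (rnorm a) => S; rewrite rnormE mulrC.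
exact: dual_bound.
Qed.
Definition luc_eval a : dual LUC := mk_dual (luc_eval_subproof a).

End ArensProducts.

Section RightIdeals.
Variables (K : fieldType) (V : lmodType K) (mul : V -> V -> V).

Definition subalgebra (S : set V) : Prop :=
  subspace_closed S /\ forall x y, S x -> S y -> S (mul x y).

Definition right_ideal (S I : set V) : Prop :=
  [/\ I `<=` S, subspace_closed I & forall x y, I x -> S y -> I (mul x y)].

Definition principal_right_ideal (S : set V) (x : V) : set V :=
  [set mul x y | y in S].

Definition right_ideals_dim_ge (S : set V) (T : Type) : Prop :=
  (forall x, S x -> x <> 0 -> dim_ge (principal_right_ideal S x) T) /\
  (forall I, right_ideal S I -> I <> [set 0] -> dim_ge I T).

End RightIdeals.

Definition directed_set (J : Type) (leJ : J -> J -> Prop) : Prop :=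
  [/\ inhabited J, forall i, leJ i i,
      forall i j k, leJ i j -> leJ j k -> leJ i k
    & forall i j, exists k, leJ i k /\ leJ j k].

Definition net_filter (J : Type) (leJ : J -> J -> Prop) : set_system J :=
  [set U | exists i, forall j, leJ i j -> U j].

Section WeakStar.
Variables (R : realType) (V : normedModType R[i]) (I : Type).

Definition weakstar_cvg (F : set_system I) (f : I -> dual V) (l : dual V) :=
  forall x : V, f i x @[i --> F] --> l x.

(* Unique when [F] is a proper filter; junk value [0] if there is no limit. *)
Definition weakstar_lim (F : set_system I) (f : I -> dual V) : dual V :=
  xget 0 [set l | weakstar_cvg F f l].

End WeakStar.

Section Multipliers.
Variables (R : realType) (A : banachAlgType R).

Definition bounded_approximate_identity (J : Type) (leJ : J -> J -> Prop)
    (e : J -> A) : Prop :=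
  [/\ directed_set leJ, bounded_set (range e),
      forall a : A, e j ** a @[j --> net_filter leJ] --> a
    & forall a : A, a ** e j @[j --> net_filter leJ] --> a].

Definition right_multiplier (T : A -> A) : Prop :=
  [/\ linear T, exists M : R, forall a, `|T a| <= M%:C * `|a|
    & forall a b, T (a ** b) = a ** T b].

Definition bounded_right_multipliers (I : Type) (T : I -> A -> A) : Prop :=
  (forall i, right_multiplier (T i)) /\
  exists M : R, forall i a, `|T i a| <= M%:C * `|a|.

(* The weak* limit of (T e_j)_j; its value at S . a is S (T a). *)
Definition luc_multiplier (J : Type) (leJ : J -> J -> Prop) (e : J -> A)
    (T : A -> A) : dual (LUC A) :=
  weakstar_lim (net_filter leJ) (fun j => luc_eval (T (e j))).

End Multipliers.

Section InitialOrdinals.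
Variables (d : Order.disp_t) (eta : orderType d).

(* The last clause: proper initial segments have smaller cardinality. *)
Definition infinite_initial_ordinal : Prop :=
  [/\ well_founded (fun x y : eta => (x < y)%O), infinite_set [set: eta]
    & forall x : eta, ~ ([set: eta] #<= [set y : eta | (y < x)%O])].

Definition cofinal_ultrafilters : set (set_system eta) :=
  [set p | UltraFilter p /\
     forall U, p U -> forall x : eta, exists2 y, U y & (x <= y)%O].

End InitialOrdinals.

Arguments cofinal_ultrafilters {d} eta.

Section Bases.
Variables (R : realType) (V : normedModType R[i]).

Definition l1_base (eta I : Type) (D : set I) (x : I -> V) : Prop :=
  [/\ bounded_set (x @` D), D #= [set: eta]
    & exists2 K : R, 0 < K &
      forall p (i : 'I_p -> I) (z : 'I_p -> R[i]),
        injective i -> (forall n, D (i n)) ->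
        \sum_(n < p) `|z n| <= K%:C * `|\sum_(n < p) z n *: x (i n)| ].

Definition spans_disjoint (I : Type) (L : I -> set V) : Prop :=
  forall i j, i <> j -> lspan (L i) `&` lspan (L j) = [set 0].

Definition l1_selective_base (eta : Type) (L : eta -> set V) : Prop :=
  [/\ bounded_set (\bigcup_i L i), forall i, L i !=set0, spans_disjoint L
    & exists2 K1 : R, 0 < K1 &
      forall p (i : 'I_p -> eta) (x : 'I_p -> V),
        injective i -> (forall n, lspan (L (i n)) (x n)) ->
        \sum_(n < p) `|x n| <= K1%:C * `|\sum_(n < p) x n| ].

End Bases.

(* The product of [b : A] with a right multiplier [a x] is the value [a x b]. *)
Section Fl1Bases.
Variables (R : realType) (A : banachAlgType R).
Variables (d : Order.disp_t) (eta : orderType d).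
Implicit Types (Aa : eta -> set A) (a : eta -> A -> A).

Definition zooming_family Aa : Prop :=
  [/\ forall x y : eta, (x <= y)%O -> Aa x `<=` Aa y,
      bounded_set (\bigcup_x Aa x)
    & closure (lspan (\bigcup_x Aa x)) = setT].

Definition zooming_set Aa a : Prop :=
  [/\ zooming_family Aa, bounded_right_multipliers a
    & spans_disjoint (fun x => a x @` Aa x)].

(* The family is indexed by the pairs (x, b) with b in Aa x. *)
Definition Fl1_base1 Aa a : Prop :=
  zooming_set Aa a /\
  l1_base eta [set xb : eta * A | Aa xb.1 xb.2] (fun xb => a xb.1 xb.2).

Definition Fl1_base2 Aa a : Prop :=
  [/\ zooming_set Aa a, l1_selective_base (fun x => a x @` Aa x)
    & exists2 K2 : R, 0 < K2 &
      forall x b, lspan (Aa x) b -> `|b| <= K2%:C * `|a x b| ].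

(* The norm chosen on A^m is the 1-norm. *)
Definition Fl1_base3 (m : nat) Aa (a : eta -> 'I_m -> A -> A) : Prop :=
  [/\ zooming_family Aa,
      bounded_right_multipliers (fun xk : eta * 'I_m => a xk.1 xk.2),
      forall k, spans_disjoint (fun x => a x k @` Aa x),
      l1_selective_base (fun x => \bigcup_k (a x k @` Aa x))
    & exists2 K2 : R, 0 < K2 &
      forall x b, lspan (Aa x) b -> `|b| <= K2%:C * \sum_(k < m) `|a x k b| ].

Definition Fl1_base (m : nat) Aa (a : eta -> 'I_m -> A -> A) : Prop :=
  [\/ m = 1%N /\ forall k, Fl1_base1 Aa (a^~ k),
      m = 1%N /\ forall k, Fl1_base2 Aa (a^~ k)
    | Fl1_base3 Aa a].

Section ClusterPoints.
Variables (J : Type) (leJ : J -> J -> Prop) (e : J -> A).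
Variables (m : nat) (a : eta -> 'I_m -> A -> A).

Definition cluster_point (p : set_system eta) (k : 'I_m) : dual (LUC A) :=
  weakstar_lim p (fun x => luc_multiplier leJ e (a x k)).

Definition cluster_points : set (dual (LUC A)) :=
  \bigcup_k [set cluster_point p k | p in cofinal_ultrafilters eta].

End ClusterPoints.

Definition norm_preserving_extension (Psi : dual (LUC A))
    (Psi' : dual (dual A)) : Prop :=
  (forall S : LUC A, Psi' S = Psi S) /\ `|Psi'| = `|Psi|.

End Fl1Bases.

(* Main.v *)
(* Fix [Psi <> 0], a functional [T] with [Psi T <> 0] and a set [U] of indices.
   Hahn-Banach on [A ^ m], applied to the base, yields [S_1, ..., S_m] in the
   dual of [A] with [\sum_k <S_k, b a_x^k> = 1_U(x) <T, b>] for [b] in [A_x].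
   Passing to the limit along a cofinal ultrafilter [p], the functional
   [\sum_k Psi_{pk} . S_k] is [T] if [U] belongs to [p] and [0] otherwise.
   Hence, for distinct [p_1, ..., p_n], the vectors [(Psi Psi_{pk})_k] of the
   [m]-th power of the ideal admit a dual system, and are linearly independent.
   So only finitely many [p] have all their [Psi Psi_{pk}] in the span of a
   given finite set, and a Hamel basis [B] of the ideal has at least as many
   finite subsets as there are cofinal ultrafilters, that is [2 ^ 2 ^ eta] by
   Hausdorff's independent family; an infinite [B] is equipotent to the set of
   its finite subsets. *)
Require Import Defs.
From HB Require Import structures.
From mathcomp Require Import all_boot all_order all_algebra.
From mathcomp Require Import complex ring lra.
From mathcomp Require Import all_classical all_reals topology normedtype.

Set Implicit Arguments.
Unset Strict Implicit.
Unset Printing Implicit Defensive.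

Import Order.TTheory GRing.Theory Num.Theory.
Import numFieldNormedType.Exports.

Local Open Scope classical_set_scope.
Local Open Scope ring_scope.

(** * Infinite cardinals and cofinal ultrafilters *)

(** [Zorn_bigcup] also asks for the union of the empty chain and gives no lower bound. Applied to
    the sets [X] whose union with [A0] satisfies [P], it settles both points: the empty chain then
    yields [A0]. *)
Lemma Zorn_above (T : Type) (P : set (set T)) (A0 : set T) : P A0 ->
  (forall F : set (set T), F !=set0 -> F `<=` P -> total_on F subset ->
     P (\bigcup_(X in F) X)) ->
  exists A, [/\ P A, A0 `<=` A & forall B, P B -> A `<=` B -> B = A].
Proof.
move=> P0 Pcup.
pose Q : set (set T) := [set X | P (A0 `|` X)].
have [F FQ Ftot|A [QA Amax]] := @Zorn_bigcup T Q.
  have [F0|/set0P F0] := eqVneq F set0.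
    by rewrite /Q /= F0 bigcup_set0 setU0.
  rewrite /Q /= (_ : A0 `|` _ = \bigcup_(X in [set A0 `|` X | X in F]) X).
    apply: Pcup.
    - by have [X FX] := F0; exists (A0 `|` X), X.
    - by move=> _ [X FX <-]; exact: FQ.
    - move=> _ _ [X FX <-] [Y FY <-].
      by have [XY|YX] := Ftot _ _ FX FY; [left|right]; exact: setUS.
  rewrite bigcup_image; apply/seteqP; split=> [x [Ax|[X FX Xx]]|x [X FX [Ax|Xx]]].
  - by have [X FX] := F0; exists X => //; left.
  - by exists X => //; right.
  - by left.
  - by right; exists X.
exists (A0 `|` A); split=> // B PB AB; apply: contrapT => nBA.
have QB : Q B by rewrite /Q /= (setUidr (subset_trans (@subsetUl _ A0 A) AB)).
apply: (Amax B) => //; rewrite properEneq; split; last first.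
  exact: subset_trans AB.
apply/eqP => AeB; apply: nBA; apply/seteqP; split=> //.
by rewrite AeB; exact: subsetUr.
Qed.

Lemma card_leTP (T U : Type) (B : set U) :
  ([set: T] #<= B)%card <->
  exists2 f : T -> U, injective f & forall x, B (f x).
Proof.
split=> [/card_leP[f]|[f finj fB]]; last first.
  have : $|{injfun [set: T] >-> B}|.
    by apply/injfunPex; exists f => [x _|x y _ _ /finj]//; exact: fB.
  by case=> g; exact: inj_card_le.
exists (fun x => val (f (SigSub (mem_set (I : [set: T] x))))) => [x y /val_inj|x].
  by move=> /(@inj _ _ _ f); rewrite !in_setT => /(_ isT isT) [].
exact/set_mem/valP.
Qed.

Lemma comparable_sets (T : pointedType) (X Y : set T) :
  (exists2 f : T -> T, set_inj X f & forall x, X x -> Y (f x)) \/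
  (exists2 f : T -> T, set_inj Y f & forall x, Y x -> X (f x)).
Proof.
pose P : set (set (T * T)) := [set G |
  [/\ forall x y, G (x, y) -> X x /\ Y y,
      forall x y y', G (x, y) -> G (x, y') -> y = y'
    & forall x x' y, G (x, y) -> G (x', y) -> x = x']].
have [F FP Ftot|G [[G1 G2 G3] Gmax]] := @Zorn_bigcup _ P.
  have common u v : (\bigcup_(G in F) G) u -> (\bigcup_(G in F) G) v ->
      exists G, [/\ P G, G u & G v].
    move=> [G FG Gu] [H FH Hv].
    have [GH|HG] := Ftot _ _ FG FH; [exists H|exists G].
      by split=> //; [exact: FP|exact: GH].
    by split=> //; [exact: FP|exact: HG].
  split=> [x y [G /FP[+ _ _]]|x y y' xy|x x' y xy]; first exact.
    by move=> /(common _ _ xy)[G [[_ + _]]]; exact.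
  by move=> /(common _ _ xy)[G [[_ _ +]]]; exact.
have [allX|/existsNP[x /not_implyP[Xx nx]]] :=
    pselect (forall x, X x -> exists y, G (x, y)).
  left; have /choice[f fP] : forall x, exists y, X x -> G (x, y).
    move=> x; have [/allX[y Gxy]|nXx] := pselect (X x); first by exists y.
    by exists point.
  exists f => [x x' /set_mem Xx /set_mem Xx' fxx'|x /fP /G1[]//].
  by apply: G3 (fP _ Xx) _; rewrite fxx'; exact: fP.
have [allY|/existsNP[y /not_implyP[Yy ny]]] :=
    pselect (forall y, Y y -> exists x, G (x, y)).
  right; have /choice[f fP] : forall y, exists x, Y y -> G (x, y).
    move=> y; have [/allY[x' Gxy]|nYy] := pselect (Y y); first by exists x'.
    by exists point.
  exists f => [y y' /set_mem Yy /set_mem Yy' fyy'|y /fP /G1[]//].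
  by apply: G2 (fP _ Yy) _; rewrite fyy'; exact: fP.
exfalso; apply: (Gmax (G `|` [set (x, y)])).
  split=> [|GG]; first exact: subsetUl.
  by apply: nx; exists y; apply: GG; right.
split=> [x1 y1 [/G1//|[-> ->]]//|x1 y1 y2|x1 x2 y1] [Ga|[xa ya]] [Gb|[xb yb]].
- exact: G2 Ga Gb.
- by case: nx; exists y1; rewrite -xb.
- by case: nx; exists y2; rewrite -xa.
- by rewrite ya yb.
- exact: G3 Ga Gb.
- by case: ny; exists x1; rewrite -yb.
- by case: ny; exists x2; rewrite -ya.
- by rewrite xa xb.
Qed.

Definition square_injection (T : Type) (D : set T) (f : T * T -> T) : Prop :=
  set_inj (D `*` D) f /\ forall x y, D x -> D y -> D (f (x, y)).

Lemma square_injection_tag (T : Type) (D : set T) (f : T * T -> T) :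
  square_injection D f -> forall t t' x x', D t -> D t' -> D x -> D x' ->
  f (t, x) = f (t', x') -> t = t' /\ x = x'.
Proof.
move=> [finj _] t t' x x' Dt Dt' Dx Dx' /finj.
by rewrite !inE /= => /(_ (conj Dt Dx) (conj Dt' Dx'))[].
Qed.

(* Zorn on the injections [D * D -> D]: for a maximal one the complement of [D]
   injects into [D], since otherwise it contains a copy of [D] by which the
   injection could be extended. *)
Lemma infinite_square (T : pointedType) : infinite_set [set: T] ->
  exists f : T * T -> T, injective f.
Proof.
move=> /infiniteP/card_leTP[h hinj _].
(* An injection is stored as its graph, and its set [D] is read off the diagonal, so inclusion of
   graphs extends [D] and the injection together. *)
pose dom (G : set (T * T * T)) := [set x | exists z, G (x, x, z)].
pose graph D (f : T * T -> T) := [set u : T * T * T | (D `*` D) u.1 /\ u.2 = f u.1].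
pose P : set (set (T * T * T)) :=
  [set G | exists2 f, square_injection (dom G) f & G = graph (dom G) f].
have domgraph D f : dom (graph D f) = D.
  apply/seteqP; split=> x; first by move=> [z [[]]].
  by move=> Dx; exists (f (x, x)).
have Pgraph D f : square_injection D f -> P (graph D f).
  by move=> Df; exists f; rewrite domgraph.
(* Starting element: on the countable set [range h], pairs are coded as pairs of naturals, [xget]
   inverting [h]. *)
pose f0 u := h (pickle (xget 0%N [set i | h i = u.1], xget 0%N [set i | h i = u.2])).
have hK i : xget 0%N [set j | h j = h i] = i.
  by apply: hinj; exact: (@xgetI _ 0%N [set j | h j = h i] i).
have P0 : P (graph (range h) f0).
  apply: Pgraph; split=> [[a b] [a' b']|_ _ [i _ <-] [j _ <-]]; last first.
    by exists (pickle (i, j)); rewrite /f0 //= !hK.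
  rewrite !inE => -[/= [i _ <-] [j _ <-]] [/= [i' _ <-] [j' _ <-]].
  by rewrite /f0 /= !hK => /hinj/(pcan_inj pickleK)[-> ->].
have [F F0 FP Ftot|G [[f Df Gf] G0 Gmax]] := Zorn_above P0.
  set G := \bigcup_(X in F) X.
  have common u v : G u -> G v -> exists H, [/\ F H, H u & H v].
    move=> [H FH Hu] [H' FH' Hv].
    by have [/(_ _ Hu)|/(_ _ Hv)] := Ftot _ _ FH FH'; [exists H'|exists H].
  have domG x : dom G x -> exists2 H, F H & dom H x.
    by move=> [z [H FH Hx]]; exists H => //; exists z.
  have GP x y : dom G x -> dom G y -> exists z, G (x, y, z).
    move=> [z Gx] [z' Gy]; have [H [FH Hx Hy]] := common _ _ Gx Gy.
    have [g _ Hg] := FP _ FH; exists (g (x, y)), H => //.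
    by rewrite Hg; split=> //; split; [exists z|exists z'].
  have Gfun u z z' : G (u, z) -> G (u, z') -> z = z'.
    move=> /common/[apply] -[H [/FP[g _ ->]]].
    by move=> [_ /= ->] [_ /= ->].
  have Gdom x y z : G (x, y, z) -> [/\ dom G x, dom G y & dom G z].
    move=> [H FH Hxyz]; have [g [_ gD] Hg] := FP _ FH.
    have domH w : dom H w -> dom G w by move=> [v Hv]; exists v, H.
    move: Hxyz; rewrite Hg => -[[/= Hx Hy] ->].
    by split; apply: domH => //; exact: gD.
  have /choice[f fP] : forall u, exists z, dom G u.1 -> dom G u.2 -> G (u, z).
    move=> [x y]; have [[Dx Dy]|nD] := pselect (dom G x /\ dom G y).
      by have [z Gz] := GP _ _ Dx Dy; exists z.
    by exists point => /= Dx Dy; case: nD.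
  exists f; last first.
    apply/seteqP; split=> [[[x y] z] Gxyz|[[x y] z] [[/= Dx Dy] ->]].
      have [Dx Dy Dz] := Gdom _ _ _ Gxyz; split=> //=.
      exact: Gfun Gxyz (fP (x, y) Dx Dy).
    exact: (fP (x, y)).
  split=> [u v|x y Dx Dy]; last first.
    by have /Gdom[] := fP (x, y) Dx Dy.
  rewrite !inE => -[/fP/[apply] Gu] [/fP/[apply] Gv] fuv.
  have [H [/FP[g [ginj _] Hg] Hu Hv]] := common _ _ Gu Gv.
  move: Hu Hv; rewrite Hg fuv => -[/= Du ->] [/= Dv guv].
  by apply: ginj; rewrite ?inE.
set D := dom G in Df Gf.
have [finj fD] := Df.
have hD i : D (h i).
  exists (f0 (h i, h i)); apply: G0; split=> //=.
  by split; exists i.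
have tag := square_injection_tag Df.
have hne i j : h i = h j -> i = j by move=> /hinj.
have [[r rinj rD]|[g ginj gD]] := comparable_sets (~` D) D.
  (* Here [T] itself embeds in [D]: [f] tags the points of [D] with [h 0] and those of the
     complement, moved by [r], with [h 1]. Then [f] pairs the images. *)
  pose phi x := if pselect (D x) then f (h 0%N, x) else f (h 1%N, r x).
  have phiD x : D (phi x).
    by rewrite /phi; case: pselect => Dx; apply: fD => //; exact: rD.
  have phi_inj : injective phi.
    move=> x y; rewrite /phi.
    case: pselect => Dx; case: pselect => Dy /tag []//; try exact: rD.
    - by move=> /hne.
    - by move=> /hne.
    - by move=> _; apply: rinj; rewrite inE.
  exists (fun u => f (phi u.1, phi u.2)) => -[x y] [x' y'] /=.
  by move=> /tag[]// /phi_inj -> /phi_inj ->.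
have {}gD x : D x -> ~ D (g x) by exact: gD.
exfalso.
(* [D'] adds to [D] its copy under [g]. A point of [D'] is coded by a tag [t] and a point [u] of
   [D], hence a pair of points by [w] in [D]. [f'] keeps [f] on pairs from [D] and sends all other
   pairs into the copy through [g], so the two ranges are disjoint. *)
pose D' := D `|` g @` D.
pose u x := if pselect (D x) then x else xget point [set y | D y /\ g y = x].
pose t x := if pselect (D x) then h 0%N else h 1%N.
have gK x : D x -> u (g x) = x.
  move=> Dx; rewrite /u; case: pselect => [Dgx|nDgx]; first by case: (gD _ Dx Dgx).
  rewrite /=; have [] := @xgetPex _ point [set y | D y /\ g y = g x] (ex_intro _ x (conj Dx erefl)).
  by move=> Dy /ginj; apply; rewrite inE.
have uD x : D' x -> D (u x).
  move=> [Dx|[y Dy <-]]; last by rewrite gK.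
  by rewrite /u; case: pselect.
have tL x : D x -> t x = h 0%N by rewrite /t; case: pselect.
have tR x : ~ D x -> t x = h 1%N by rewrite /t; case: pselect.
have u_inj x y : D' x -> D' y -> t x = t y -> u x = u y -> x = y.
  move=> [Dx|[x' Dx' <-]] [Dy|[y' Dy' <-]].
  - by rewrite /u; case: pselect => //; case: pselect.
  - by rewrite (tL x)// (tR (g y'))// => [/hne|]; last exact: gD.
  - by rewrite (tL y)// (tR (g x'))// => [/hne|]; last exact: gD.
  - by move=> _; rewrite !gK// => ->.
have tD x : D (t x) by rewrite /t; case: pselect => ? /=.
pose w v := f (f (t v.1, u v.1), f (t v.2, u v.2)).
pose f' v := if pselect (D v.1 /\ D v.2) then f v else g (w v).
have wD v : D' v.1 -> D' v.2 -> D (w v).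
  by move=> /uD D1 /uD D2; apply: (fD); apply: fD.
have w_inj v v' : D' v.1 -> D' v.2 -> D' v'.1 -> D' v'.2 -> w v = w v' -> v = v'.
  case: v v' => [x y] [x' y'] /= Dx Dy Dx' Dy'.
  move=> /tag[]; try by apply: fD => //; exact: uD.
  move=> /tag[]//; try exact: uD; move=> tx ux.
  move=> /tag[]//; try exact: uD; move=> ty uy.
  by congr pair; exact: u_inj.
have D'f : square_injection D' f'.
  split=> [v v'|x y D'x D'y]; last first.
    rewrite /f'; case: pselect => /= [[Dx Dy]|_]; first by left; exact: fD.
    by right; exists (w (x, y)) => //; exact: wD.
  move=> /set_mem[v1 v2] /set_mem[v1' v2']; rewrite /f'.
  case: pselect => Dv; case: pselect => Dv'.
  - by apply: finj; rewrite inE.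
  - case: v Dv {v1 v2} => x y /= [Dx Dy] fg; exfalso; apply: gD (wD v' v1' v2') _.
    by rewrite -fg; exact: fD.
  - case: v' Dv' {v1' v2'} => x y /= [Dx Dy] fg; exfalso; apply: gD (wD v v1 v2) _.
    by rewrite fg; exact: fD.
  - move=> gww; apply: w_inj => //; apply: ginj gww; rewrite inE; exact: wD.
have DD' : D `<=` D' by exact: subsetUl.
have GG' : G `<=` graph D' f'.
  rewrite Gf => -[[x y] z] [[/= Dx Dy] ->]; split=> /=; first by split; exact: DD'.
  by rewrite /f'; case: pselect => // -[].
(* Maximality forces [D' = D], although [g (h 0)] lies outside [D]. *)
have GE := Gmax _ (Pgraph D' f' D'f) GG'.
have : D (g (h 0%N)).
  have -> : D = dom (graph D' f') by rewrite GE.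
  by rewrite domgraph; right; exists (h 0%N).
exact: gD.
Qed.

(** A list is coded by its length and the right fold of the pairing. The fold alone is ambiguous;
    the length tells how often to unpair. *)
Lemma infinite_seq_inj (T : pointedType) : infinite_set [set: T] ->
  exists f : seq T -> T, injective f.
Proof.
move=> Tinf; have [f finj] := infinite_square Tinf.
have /infiniteP/card_leTP[h hinj _] := Tinf.
pose g := foldr (fun x c => f (x, c)) (h 0%N).
exists (fun s => f (h (size s), g s)) => s s' /finj[/hinj].
by elim: s s' => [|x s IHs] [|x' s']//= [/IHs{}IHs] /finj[-> /IHs ->].
Qed.

Lemma infinite_inhabited_pointed (T : choiceType) : infinite_set [set: T] ->
  exists P : pointedType, exists2 f : T -> P, bijective f & infinite_set [set: P].
Proof.
move=> Tinf; have /infiniteP/card_leTP[h _ _] := Tinf.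
pose M := isPointed.Build T (h 0%N).
exists (HB.pack T M : pointedType), id => //; exact: (Bijective (g := id)).
Qed.

(* [t] lists the traces on [s] of the subsets of [T] that the pair is
   declared to belong to: Hausdorff's independent family. *)
Definition trace_family (T : eqType) (A : set T) : set (seq T * seq (seq T)) :=
  [set u : seq T * seq (seq T) | [seq x <- u.1 | x \in A] \in u.2].

(** Once a finite [s] separates every member of [s1] from every member of [s2], declaring exactly
    the traces of the members of [s1] works. Prepending an arbitrary [x] to [s] keeps the separation
    and gives one witness per point of [T], which later makes the intersections unbounded in
    [eta]. *)
Lemma trace_family_independent (T : choiceType) (s1 s2 : seq (set T)) :
  (forall A B, A \in s1 -> B \in s2 -> A <> B) ->
  exists2 f : T -> seq T * seq (seq T), injective f & forall x,
    (forall A, A \in s1 -> trace_family A (f x)) /\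
    (forall B, B \in s2 -> ~ trace_family B (f x)).
Proof.
move=> s12.
have sep (A B : set T) : A <> B -> exists x, (x \in A) != (x \in B).
  move=> AB; apply: contrapT => /forallNP AeB; apply: AB.
  apply/seteqP; split=> x; have /negP := AeB x; rewrite negbK => /eqP AB.
    by move=> /mem_set; rewrite AB => /set_mem.
  by move=> /mem_set; rewrite -AB => /set_mem.
have [s sP] : exists s : seq T, forall A B, A \in s1 -> B \in s2 ->
    has (fun x => (x \in A) != (x \in B)) s.
  have : forall A, A \in s1 -> forall B, B \in s2 -> A <> B.
    by move=> A As B; exact: s12.
  elim: s1 {s12} => [|A0 s1 IH] s12; first by exists [::].
  have [|s sP] := IH; first by move=> A As; apply: s12; rewrite inE As orbT.
  have {}s12 := s12 A0 (mem_head _ _).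
  suff [s' s'P] : exists s', forall B, B \in s2 ->
      has (fun x => (x \in A0) != (x \in B)) s'.
    exists (s' ++ s) => A B; rewrite inE has_cat => /predU1P[->|As] Bs.
      by rewrite s'P.
    by rewrite sP ?orbT.
  elim: s2 s12 {sP IH} => [|B0 s2 IH] s12; first by exists [::].
  have [|s' s'P] := IH; first by move=> B Bs; apply: s12; rewrite inE Bs orbT.
  have [x xP] := sep _ _ (s12 B0 (mem_head _ _)).
  exists (x :: s') => B; rewrite inE => /predU1P[->/=|/s'P /= ->].
    by rewrite xP.
  by rewrite orbT.
pose tr (x : T) (A : set T) := [seq y <- x :: s | y \in A].
exists (fun x => (x :: s, [seq tr x A | A <- s1])) => [x y []//|x].
split=> [A As|B Bs]; first exact: map_f.
move=> /mapP[A As /= trE]; have /hasP[y ys] := sP A B As Bs.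
apply/negP; rewrite negbK; apply/eqP.
have : (y \in [seq z <- x :: s | z \in A]) = (y \in [seq z <- x :: s | z \in B]).
  by rewrite /= trE.
by rewrite !mem_filter inE ys orbT !andbT.
Qed.

(** Otherwise [f] would embed [eta] in a proper initial segment, against initiality. *)
Lemma not_bounded_of_inj (d : Order.disp_t) (eta : orderType d) (f : eta -> eta) x :
  infinite_initial_ordinal eta -> injective f -> exists y, (x <= f y)%O.
Proof.
move=> [_ _ etaP] finj; apply: contrapT => /forallNP fx.
apply: (etaP x); apply/card_leTP; exists f => // y /=.
by rewrite ltNge; exact/negP/fx.
Qed.

(* Pospisil's theorem for uniform ultrafilters. *)
Lemma many_cofinal_ultrafilters (d : Order.disp_t) (eta : orderType d) :
  infinite_initial_ordinal eta ->
  exists2 P : set (set eta) -> set_system eta, injective P &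
    forall X, cofinal_ultrafilters eta (P X).
Proof.
move=> heta; have [_ etainf _] := heta.
(* Finite data over [eta] are coded back into [eta], so the independent family can be realised by
   subsets [I A] of [eta]. *)
have [c cinj] : exists c : seq eta * seq (seq eta) -> eta, injective c.
  have [P [j [k jK kK] Pinf]] := infinite_inhabited_pointed etainf.
  have [f finj] := infinite_seq_inj Pinf; have [g ginj] := infinite_square Pinf.
  pose code s := f (map j s).
  have code_inj : injective code by move=> s t /finj /(inj_map (can_inj jK)).
  exists (fun u => k (g (code u.1, f (map code u.2)))) => -[s t] [s' t'] /=.
  by move=> /(can_inj kK)/ginj[/code_inj -> /finj/(inj_map code_inj) ->].
pose I A : set eta := c @` trace_family A.
pose index : Type := (seq (set eta) * seq (set eta) * eta)%type.
(* [X] determines a filter base: finitely many [I A] with [A] in [X], finitely many complements of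
   [I B] with [B] outside [X], and a final segment. The final segments make every ultrafilter above
   it cofinal. *)
pose base (X : set (set eta)) : set index :=
  [set u : index | (forall A, A \in u.1.1 -> X A) /\ (forall B, B \in u.1.2 -> ~ X B)].
pose basic (u : index) : set eta :=
  [set y | [/\ forall A, A \in u.1.1 -> I A y,
               forall B, B \in u.1.2 -> ~ I B y & (u.2 <= y)%O]].
have proper X : ProperFilter (filter_from (base X) basic).
  apply: filter_from_proper; last first.
    move=> [[s1 s2] x] [/= Xs1 Xs2].
    have [A B As Bs AB|f finj fP] := @trace_family_independent _ s1 s2.
      by apply: (Xs2 B) => //; rewrite -AB; exact: Xs1.
    have [y xy] := not_bounded_of_inj x heta (inj_comp cinj finj).
    exists (c (f y)); split=> //= [A As|B Bs].
      by exists (f y) => //; exact: (fP y).1.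
    by move=> [u uB /cinj uE]; apply: (fP y).2 Bs _; rewrite -uE.
  apply: filter_from_filter.
    have /infiniteP/card_leTP[h _ _] := etainf.
    by exists ([::], [::], h 0%N); split.
  move=> [[s1 s2] x] [[t1 t2] y] [/= Xs1 Xs2] [/= Xt1 Xt2].
  exists (s1 ++ t1, s2 ++ t2, Order.max x y).
    by split=> A /=; rewrite mem_cat => /orP[]; auto.
  move=> z [/= z1 z2]; rewrite ge_max => /andP[xz yz].
  by split; split=> //= A As; (apply: z1 || apply: z2); rewrite mem_cat As ?orbT.
have /choice[P PP] : forall X, exists G, UltraFilter G /\
    filter_from (base X) basic `<=` G.
  by move=> X; have := proper X; exact: ultraFilterLemma.
have /infiniteP/card_leTP[h _ _] := etainf.
have PF X u U : base X u -> basic u `<=` U -> P X U.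
  by move=> Xu uU; have [_] := PP X; apply; exists u.
have PI X A : X A -> P X (I A).
  move=> XA; apply: (@PF X ([:: A], [::], h 0%N)).
    by split=> //= B; rewrite inE => /eqP ->.
  by move=> y [/= + _ _]; apply; rewrite inE.
have PIC X A : ~ X A -> P X (~` I A).
  move=> XA; apply: (@PF X ([::], [:: A], h 0%N)).
    by split=> //= B; rewrite inE => /eqP ->.
  by move=> y [/= _ + _]; apply; rewrite inE.
have Pproper X : ProperFilter (P X) by have [+ _] := PP X; exact: @ultra_proper.
have disj X A : ~ (P X (I A) /\ P X (~` I A)).
  move=> [PA PcA]; apply: (@filter_not_empty _ (P X)).
  by rewrite -(setICr (I A)); exact: filterI.
(* [X] is recovered from [P X] as the set of all [A] with [I A] in [P X]. *)
exists P => [X Y PXY|X].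
  apply/seteqP; split=> A; apply: contraPP => nA.
    by move=> XA; apply: (disj Y A); split; [rewrite -PXY; exact: PI|exact: PIC].
  by move=> YA; apply: (disj X A); split; [rewrite PXY; exact: PI|exact: PIC].
split; first exact: (PP X).1.
move=> U PU x; have : P X [set y | (x <= y)%O].
  by apply: (@PF X ([::], [::], x)) => [|y []].
by move=> /(filterI PU)/filter_ex[y [Uy xy]]; exists y.
Qed.

(** * Dimension *)

Lemma linear_zero (K : pzRingType) (V W : lmodType K) (f : V -> W) : linear f -> f 0 = 0.
Proof. by move=> lf; have := lf (-1) 0 0; rewrite scaler0 addr0 scaleN1r addNr. Qed.

Lemma linear_sum_fun (K : pzRingType) (V W : lmodType K) (f : V -> W) (I : Type)
  (r : seq I) (F : I -> V) :
  linear f -> f (\sum_(i <- r) F i) = \sum_(i <- r) f (F i).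
Proof.
move=> lf; apply: (big_morph f); last exact: linear_zero.
by move=> x y; have := lf 1 x y; rewrite !scale1r.
Qed.

Lemma linear_image_lspan (K : fieldType) (V W : lmodType K) (f : V -> W) (E : set V) x :
  linear f -> lspan E x -> lspan (f @` E) (f x).
Proof.
move=> lf [n [c [v [Ev ->]]]]; exists n, c, (f \o v).
split=> [i|]; first by exists (v i).
rewrite linear_sum_fun//; apply: eq_bigr => i _.
by have := lf (c i) (v i) 0; rewrite (linear_zero lf) !addr0.
Qed.

Lemma lspan_le (K : fieldType) (V : lmodType K) (E E' : set V) :
  E `<=` E' -> lspan E `<=` lspan E'.
Proof.
move=> EE'; apply: lspan_min (lspan_subspace _) _.
by apply: subset_trans EE' _; exact: lspan_sub.
Qed.

Section Dimension.
Variables (K : fieldType) (V : lmodType K).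
Implicit Types (W B : set V).

Lemma chain_finite (T : Type) (F : set (set T)) n (v : 'I_n -> T) :
  F !=set0 -> total_on F subset -> (forall i, (\bigcup_(X in F) X) (v i)) ->
  exists2 X, F X & forall i, X (v i).
Proof.
move=> [X0 FX0] Ftot; elim: n v => [|n IH] v Fv; first by exists X0 => // -[].
have [X FX Xv] := IH (fun i => v (lift ord0 i)) (fun i => Fv _).
have [Y FY Yv] := Fv ord0.
have [XY|YX] := Ftot _ _ FX FY; [exists Y|exists X] => // i.
- by case: (unliftP ord0 i) => [j ->|->//]; exact/XY/Xv.
- by case: (unliftP ord0 i) => [j ->|->]; [exact: Xv|exact: YX].
Qed.

(** [dim_ge] asks for a basis to exist. Zorn gives a maximal independent subset of [W], and a vector
    of [W] outside its span could be added. *)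
Lemma Hamel_basis_exists W : subspace_closed W -> exists B, hamel_basis W B.
Proof.
move=> Wsub; pose P B := B `<=` W /\ lin_indep B.
have P0 : P set0.
  by split=> // n c v _ v0 _ i; have := v0 i.
have [F F0 FP Ftot|B [[BW Bind] _ Bmax]] := Zorn_above P0.
  split=> [x [X /FP[XW _] /XW]//|n c v vinj Fv cv].
  have [X /FP[_ Xind] Xv] := chain_finite F0 Ftot Fv.
  exact: (Xind n c v).
exists B; split=> //; apply/seteqP; split=> [|x Wx].
  exact: lspan_min.
apply: contrapT => nx.
have [_ spanD] := lspan_subspace B.
have nBx : ~ B x by move=> /lspan_sub.
suff BxE : x |` B = B by apply: nBx; rewrite -BxE; left.
apply: Bmax; last exact: subsetUr.
split=> [y [->//|/BW//]|n c v vinj Bv cv].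
have [[i0 vi0]|nv] := pselect (exists i, v i = x); last first.
  apply: (Bind n c v) => // i.
  by have [vx|//] := Bv i; case: nv; exists i.
have vB i : i != i0 -> B (v i).
  by move=> ii0; have [/= vx|//] := Bv i; case/eqP: ii0; apply: vinj; rewrite vx vi0.
case: n c v vinj Bv cv i0 vi0 vB => [|n] c v vinj Bv cv i0 vi0 vB; first by case: i0 {vi0 vB}.
move: cv; rewrite (bigD1_ord i0)//= vi0 => cv.
have vB' j : B (v (lift i0 j)) by apply: vB; rewrite eq_sym neq_lift.
have c0 : c i0 = 0.
  apply/eqP/negPn/negP => c0; apply: nx.
  exists n, (fun j => - (c i0)^-1 * c (lift i0 j)), (fun j => v (lift i0 j)); split=> //.
  under eq_bigr do rewrite -scalerA.
  rewrite -scaler_sumr scaleNr; move/eqP: cv; rewrite addr_eq0 => /eqP cv.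
  by rewrite -scalerN -cv scalerA mulVf// scale1r.
move: cv; rewrite c0 scale0r add0r => cv i.
case: (unliftP i0 i) => [j ->|->//].
by apply: (Bind n _ _ _ vB' cv) => j1 j2 /vinj; exact: lift_inj.
Qed.

Lemma lspan_seq (s : seq V) x : lspan [set` s] x ->
  exists c : 'I_(size s) -> K, x = \sum_(t < size s) c t *: s`_t.
Proof.
apply: (@lspan_min _ _ _ [set x | exists c : 'I_(size s) -> K, x = \sum_(t < size s) c t *: s`_t]).
  split=> [|a _ _ [c ->] [c' ->]].
    by exists (fun=> 0); rewrite big1// => t _; rewrite scale0r.
  exists (fun t => a * c t + c' t); rewrite scaler_sumr -big_split; apply: eq_bigr => t _.
  by rewrite scalerDl scalerA.
move=> y /= /[dup] ys /(nth_index 0) <-.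
move: ys; rewrite -index_mem => ys.
exists (fun t => (t == Ordinal ys)%:R); rewrite (bigD1 (Ordinal ys))//= eqxx scale1r.
by rewrite big1 ?addr0// => t /negPf ->; rewrite scale0r.
Qed.

Lemma lspan_finite_support B m (y : 'I_m -> V) : (forall k, lspan B (y k)) ->
  exists2 s : seq V, (forall x, x \in s -> B x) & forall k, lspan [set` s] (y k).
Proof.
move=> By; have /choice[s sP] : forall k, exists s : seq V,
    (forall x, x \in s -> B x) /\ lspan [set` s] (y k).
  move=> k; have [n [c [v [Bv ->]]]] := By k.
  exists [seq v i | i <- enum 'I_n]; split=> [x /mapP[i _ ->]//|].
  by exists n, c, v; split=> // i; apply/map_f; rewrite mem_enum.
exists (flatten [seq s k | k <- enum 'I_m]) => [x /flatten_mapP[k _ /(sP k).1]//|k].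
have sub : [set` s k] `<=` [set` flatten [seq s k | k <- enum 'I_m]].
  by move=> x /= xs; apply/flatten_mapP; exists k => //; rewrite mem_enum.
exact: (lspan_le sub (sP k).2).
Qed.

Variables (T : Type) (m : nat) (v : T -> 'I_m -> V).

(* The vectors [v x] of [V ^ m] have, over any finite set of indices, a dual
   system of functionals on [V ^ m]. *)
Definition has_dual_systems : Prop := forall n (q : 'I_n -> T), injective q ->
  exists l : 'I_n -> 'I_m -> V -> K^o, (forall i k, linear (l i k)) /\
    forall i j, \sum_(k < m) l i k (v (q j) k) = (i == j)%:R.

Hypothesis vsep : has_dual_systems.

(** The identity matrix of size [n] factors as the matrix [L] of values of the [l i k] on the
    vectors of [s] times the transpose of the coefficient matrix [C]. Both have [m * size s]
    columns, which bounds the rank. *)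
Lemma dual_systems_rank (s : seq V) n (q : 'I_n -> T) : injective q ->
  (forall j k, lspan [set` s] (v (q j) k)) -> (n <= m * size s)%N.
Proof.
move=> qinj sv; have [l [llin lE]] := vsep qinj.
have /choice[c cP] : forall jk : 'I_n * 'I_m, exists c : 'I_(size s) -> K,
    v (q jk.1) jk.2 = \sum_(t < size s) c t *: s`_t.
  by move=> [j k]; apply: lspan_seq; exact: sv.
pose L := \matrix_(i < n) mxvec (\matrix_(k < m, t < size s) (l i k s`_t : K)).
pose C := \matrix_(j < n) mxvec (\matrix_(k < m, t < size s) c (j, k) t).
have LC : L *m C^T = 1%:M.
  apply/matrixP => i j; rewrite [LHS]mxE [RHS]mxE -lE.
  rewrite (reindex _ (curry_mxvec_bij _ _)) [LHS](eq_bigr (fun p =>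
    L i (mxvec_index p.1 p.2) * C^T (mxvec_index p.1 p.2) j)); last by case.
  rewrite -(pair_bigA _ (fun k t => L i (mxvec_index k t) * C^T (mxvec_index k t) j)).
  apply: eq_bigr => k _; rewrite (cP (j, k)) linear_sum_fun//.
  apply: eq_bigr => t _; rewrite !mxE !mxvecE !mxE mulrC.
  by have := llin i k (c (j, k) t) s`_t 0; rewrite (linear_zero (llin i k)) !addr0.
have : (\rank (L *m C^T) <= m * size s)%N.
  by rewrite (leq_trans (mulmx_max_rank _ _)).
by rewrite LC mxrank1.
Qed.

Lemma dual_systems_finite_fiber (s : seq V) :
  finite_set [set x | forall k, lspan [set` s] (v x k)].
Proof.
apply: contrapT => /infiniteP/card_leTP[h hinj hs].
have := @dual_systems_rank s (m * size s).+1 (fun i => h i).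
by rewrite ltnn => H; suff : false by []; apply: H => [i j /hinj/val_inj|j k]; last exact: hs.
Qed.

(** Each index is determined by a finite list from [B] whose span contains its vectors and by a
    number inside the finite fibre over that list. An infinite [B] absorbs such pairs. *)
Lemma dim_ge_of_dual_systems W : subspace_closed W -> (forall x k, W (v x k)) ->
  infinite_set [set: T] -> dim_ge W T.
Proof.
move=> Wsub Wv Tinf; have [B BW] := Hamel_basis_exists Wsub; exists B => //.
have [Bind spanB] := BW.
(* A finite basis would put all of [T] in one fibre, which is finite. *)
have [/finite_seqP[s BE]|Binf] := pselect (finite_set B).
  exfalso; apply: Tinf; apply: sub_finite_set (dual_systems_finite_fiber s) => x _ k.
  by rewrite -BE spanB.
have /choice[f fP] : forall x, exists s : seq V,
    (forall b, b \in s -> B b) /\ forall k, lspan [set` s] (v x k).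
  move=> x; have [|s sB sv] := @lspan_finite_support B m (v x); last by exists s.
  by move=> k; rewrite spanB.
pose SB := {b | b \in B}.
have SBinf : infinite_set [set: SB].
  move/infiniteP/card_leTP : Binf => [h hinj hB].
  apply/infiniteP/card_leTP; exists (fun i => Sub (h i) (mem_set (hB i)) : SB) => //.
  by move=> i j /(congr1 val) /hinj.
have [P [j [j' jK j'K] Pinf]] := infinite_inhabited_pointed SBinf.
have [code code_inj] := infinite_seq_inj Pinf.
have /infiniteP/card_leTP[h hinj _] := Pinf.
have [pr pr_inj] := infinite_square Pinf.
have /choice[g gP] : forall s : seq V, exists g : T -> nat,
    {in [set x | forall k, lspan [set` s] (v x k)] &, injective g}.
  move=> s; apply/countable_injP; apply: finite_set_countable.
  exact: dual_systems_finite_fiber.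
pose lift s : seq P := [seq j b | b <- pmap (insub : V -> option SB) s].
have lift_inj x y : lift (f x) = lift (f y) -> f x = f y.
  move=> /(inj_map (can_inj jK)) /(congr1 (map val)).
  have liftK z : map val (pmap (insub : V -> option SB) (f z)) = f z.
    rewrite (pmap_filter (@insubK _ _ SB)); apply/all_filterP/allP => b bz /=.
    by rewrite isSome_insub; apply/mem_set; exact: (fP z).1.
  by rewrite !liftK.
apply/card_leTP.
exists (fun x => val (j' (pr (code (lift (f x)), h (g (f x) x))))) => [x y|x]; last first.
  exact/set_mem/valP.
move=> /val_inj/(can_inj j'K)/pr_inj[/code_inj/lift_inj fxy /hinj gxy].
apply: (gP (f x)); rewrite ?inE; [exact: (fP x).2| |].
  by rewrite fxy; exact: (fP y).2.
by rewrite gxy fxy.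
Qed.

End Dimension.

(** * Hahn-Banach and interpolation on the base *)

Local Open Scope complex_scope.

Lemma normr_i (R : rcfType) : `|'i%C : R[i]| = 1.
Proof. by rewrite normc_def /= expr0n expr1n add0r sqrtr1. Qed.

Lemma normr_realc (R : rcfType) (r : R) : `|r%:C| = `|r|%:C.
Proof. by rewrite normc_def /= expr0n addr0 sqrtr_sqr. Qed.

Section HahnBanach.
Variables (R : realType) (V : lmodType R[i]) (p : V -> R).
Hypothesis p_subadd : forall x y, p (x + y) <= p x + p y.
Hypothesis p_homog : forall (c : R[i]) x, (p (c *: x))%:C = `|c| * (p x)%:C.

Let p_realZ (c : R) x : p (c%:C *: x) = `|c| * p x.
Proof. by apply: complexI; rewrite p_homog realcM normr_realc. Qed.

(** Graphs of partial real-linear functionals, so that extension is inclusion. Being single-valued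
    is a consequence of the domination by [p], as [p 0 = 0]. *)
Definition dominated_real_graph (G : set (V * R)) : Prop :=
  [/\ G (0, 0),
      forall (c : R) u v, G u -> G v -> G (c%:C *: u.1 + v.1, c * u.2 + v.2)
    & forall u, G u -> u.2 <= p u.1].

(** The value at [x0] must lie above every [u.2 - p (u.1 - x0)] and below every
    [p (v.1 + x0) - v.2]. Subadditivity makes this possible, and [a] is the supremum of the lower
    bounds. A nonzero [c] reduces to [1] or [-1] by dividing by its absolute value. *)
Lemma dominated_one_step (G : set (V * R)) x0 : dominated_real_graph G ->
  exists a : R, forall (c : R) u, G u -> c * a + u.2 <= p (c%:C *: x0 + u.1).
Proof.
move=> [G0 GD Gp].
pose E := [set u.2 - p (u.1 - x0) | u in G].
have bd v : G v -> ubound E (p (v.1 + x0) - v.2).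
  move=> Gv _ [u Gu <-]; rewrite lerBrDr addrAC lerBlDr.
  have := GD 1 u v Gu Gv; rewrite scale1r mul1r => /Gp /= /le_trans; apply.
  by rewrite [leRHS]addrC (le_trans _ (p_subadd _ _))// addrACA addNr addr0.
have Esup : has_sup E.
  by split; [exists (0 - p (0 - x0)), (0, 0)|exists (p (0 + x0) - 0); exact: (bd (0, 0))].
exists (sup E) => c u Gu.
have GZ t : G (t%:C *: u.1, t * u.2).
  by have := GD t _ _ Gu G0; rewrite !addr0.
have sc t y z : 0 < t -> t * p (t^-1%:C *: y + z) = p (y + t%:C *: z).
  move=> t0; rewrite -{1}(gtr0_norm t0) -p_realZ scalerDr scalerA -realcM.
  by rewrite mulfV ?gt_eqF// scale1r.
have [c0|c0|->] := ltgtP c 0; last by rewrite mul0r add0r scale0r add0r Gp.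
- have t0 : 0 < - c by rewrite oppr_gt0.
  have : (- c)^-1 * u.2 - p ((- c)^-1%:C *: u.1 - x0) <= sup E.
    apply: sup_upper_bound => //.
    by exists ((- c)^-1%:C *: u.1, (- c)^-1 * u.2).
  move=> /(ler_wpM2l (ltW t0)); rewrite mulrBr mulVKf ?gt_eqF//.
  rewrite sc// rmorphN scaleNr scalerN opprK [_ + u.1]addrC; lra.
- have : sup E <= p (c^-1%:C *: u.1 + x0) - c^-1 * u.2.
    by apply: ge_sup; [case: Esup|exact: (bd (c^-1%:C *: u.1, c^-1 * u.2))].
  move=> /(ler_wpM2l (ltW c0)); rewrite mulrBr mulVKf ?gt_eqF//.
  rewrite sc// [_ + u.1]addrC; lra.
Qed.

Lemma real_Hahn_Banach (G0 : set (V * R)) : dominated_real_graph G0 ->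
  exists f : V -> R,
    [/\ forall (c : R) x y, f (c%:C *: x + y) = c * f x + f y,
        forall x, f x <= p x & forall u, G0 u -> f u.1 = u.2].
Proof.
move=> G0P.
have [F [G1 FG1] FP Ftot|G [GP G0G Gmax]] := Zorn_above G0P.
  have common u v : (\bigcup_(G in F) G) u -> (\bigcup_(G in F) G) v ->
      exists2 G, F G & G u /\ G v.
    move=> [G FG Gu] [H FH Hv].
    have [GH|HG] := Ftot _ _ FG FH; [exists H|exists G] => //; split=> //.
      exact: GH.
    exact: HG.
  split=> [|c u v Gu Gv|u [G FG Gu]].
  - by exists G1 => //; have [] := FP _ FG1.
  - have [H FH [Hu Hv]] := common _ _ Gu Gv.
    by exists H => //; have [_ + _] := FP _ FH; apply.
  - by have [_ _] := FP _ FG; apply.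
have [GG0 GD Gp] := GP.
have Gfun x r s : G (x, r) -> G (x, s) -> r = s.
  move=> Gr Gs.
  have le r1 r2 : G (x, r1) -> G (x, r2) -> r1 <= r2.
    move=> G1 G2; have := Gp _ (GD (-1) _ _ G2 G1).
    rewrite /= rmorphN rmorph1 scaleN1r mulN1r addNr.
    have -> : p 0 = 0 by have := p_realZ 0 0; rewrite scaler0 normr0 mul0r.
    by rewrite addrC subr_le0.
  by apply/eqP; rewrite eq_le !le.
have Gtot x : exists r, G (x, r).
  have [a aP] := dominated_one_step x GP.
  pose G' := [set u : V * R | exists c v, G v /\ u = (c%:C *: x + v.1, c * a + v.2)].
  suff G'E : G' = G.
    exists a; rewrite -G'E; exists 1, (0, 0); split=> //.
    by rewrite /= rmorph1 scale1r mul1r !addr0.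
  apply: Gmax => [|[y r] Gyr]; last first.
    by exists 0, (y, r); split=> //=; rewrite rmorph0 scale0r mul0r !add0r.
  split=> [|c _ _ [c1 [u1 [Gu1 ->]]] [c2 [u2 [Gu2 ->]]]|_ [c [v [Gv ->]]]].
  - by exists 0, (0, 0); split=> //=; rewrite rmorph0 scale0r mul0r !add0r.
  - exists (c * c1 + c2), (c%:C *: u1.1 + u2.1, c * u1.2 + u2.2); split; first exact: GD.
    congr pair => /=; last by rewrite mulrDl mulrDr -mulrA addrACA.
    by rewrite scalerDr scalerA realcD realcM scalerDl addrACA.
  - exact: aP.
have /choice[f fG] := Gtot.
exists f; split=> [c x y|x|[x r] /G0G Gx]; last exact: Gfun Gx.
  exact: Gfun (fG _) (GD c _ _ (fG x) (fG y)).
exact: (Gp (x, f x)).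
Qed.

(* Taking real parts; the constant 2 bounds the modulus by the two parts and
   saves the usual rotation argument. *)
Lemma complex_Hahn_Banach (G : set (V * R[i])) :
  G (0, 0) ->
  (forall (c : R[i]) u v, G u -> G v -> G (c *: u.1 + v.1, c * u.2 + v.2)) ->
  (forall u, G u -> `|u.2| <= (p u.1)%:C) ->
  exists f : V -> R[i]^o,
    [/\ linear f, forall x, `|f x| <= 2 * (p x)%:C & forall u, G u -> f u.1 = u.2].
Proof.
move=> G0 GD Gp.
pose Gr := [set (u.1, complex.Re u.2) | u in G].
have [|f [flin fp fG]] := @real_Hahn_Banach Gr.
  split=> [|c _ _ [u Gu <-] [v Gv <-]|_ [u Gu <-]]; first by exists (0, 0).
    exists (c%:C *: u.1 + v.1, c%:C * u.2 + v.2); first exact: GD.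
    by congr pair => //=; rewrite raddfD /=; case: u.2 => a b /=; rewrite mul0r subr0.
  rewrite -lecR (le_trans _ (Gp _ Gu))// (le_trans _ (normc_ge_Re _))//.
  by rewrite lecR ler_norm.
have f0 : f 0 = 0.
  by have := flin (-1) 0 0; rewrite scaler0 addr0 mulN1r addNr.
have fD x y : f (x + y) = f x + f y.
  by have := flin 1 x y; rewrite rmorph1 scale1r mul1r.
have fZ (c : R) x : f (c%:C *: x) = c * f x.
  by have := flin c x 0; rewrite f0 !addr0.
have fN x : f (- x) = - f x.
  by have := fZ (-1) x; rewrite rmorphN rmorph1 scaleN1r mulN1r.
have fabs x : `|f x| <= p x.
  rewrite ler_norml fp andbT lerNl -fN (le_trans (fp _))//.
  by rewrite -scaleN1r -[-1](rmorphN1 (real_complex R)) p_realZ normrN1 mul1r.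
have fZi (c : R[i]) x :
    f (c *: x) = complex.Re c * f x + complex.Im c * f ('i%C *: x).
  by rewrite {1}[c]complexE mulrC scalerDl -scalerA fD !fZ.
have fiZ (c : R[i]) x :
    f ('i%C *: (c *: x)) = complex.Re c * f ('i%C *: x) - complex.Im c * f x.
  by rewrite scalerA mulrC -scalerA fZi (scalerA 'i%C) -expr2 sqr_i scaleN1r fN mulrN.
(* The complex-linear functional with real part [f]: its imaginary part at [x] is minus the value of
   [f] at [i x]. *)
exists (fun x => f x +i* - f ('i%C *: x)); split=> [c x y|x|[x c] Gx].
- have E1 : f (c *: x + y) =
      complex.Re c * f x + complex.Im c * f ('i%C *: x) + f y by rewrite fD fZi.
  have E2 : f ('i%C *: (c *: x + y)) =
      complex.Re c * f ('i%C *: x) - complex.Im c * f x + f ('i%C *: y).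
    by rewrite scalerDr fD fiZ.
  rewrite E1 E2.
  case: c {E1 E2} => a b; have E (r s t w : R) :
      (a +i* b) * (r +i* s) + (t +i* w) = (a * r - b * s + t) +i* (a * s + b * r + w).
    by [].
  apply: etrans (esym (E _ _ _ _)) => /=.
  by congr (_ +i* _); ring.
- have pi : p ('i%C *: x) = p x by apply: complexI; rewrite p_homog normr_i mul1r.
  rewrite [X in `|X|]complexE /= (le_trans (ler_normD _ _))// mulr_natl mulr2n.
  by rewrite normrM normr_i mul1r !normr_realc normrN; apply: lerD; rewrite lecR// -pi.
- have := GD 'i%C _ _ Gx G0; rewrite /= !addr0 => Gix.
  have /fG/= -> : Gr (x, complex.Re c) by exists (x, c).
  have /fG/= -> : Gr ('i%C *: x, complex.Re ('i%C * c)).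
    by exists ('i%C *: x, 'i%C * c).
  by case: c {Gx Gix} => a b; rewrite /= mul0r sub0r mul1r opprK.
Qed.

End HahnBanach.

Lemma big_if_mem (V : nmodType) (I : eqType) (r s : seq I) (F : I -> V) :
  uniq r -> uniq s -> {subset s <= r} ->
  \sum_(i <- r) (if i \in s then F i else 0) = \sum_(i <- s) F i.
Proof.
move=> ur us sr; rewrite -big_mkcond -big_filter; apply: perm_big.
apply: uniq_perm => // [|i]; first exact: filter_uniq.
by rewrite mem_filter; case: (boolP (i \in s)) => //= /sr.
Qed.

(* Each [phi i] carries a prescribed functional [psi i] on its own subspace
   [E i]; taking [W] one-dimensional prescribes single values. *)
Lemma selective_interpolation (R : realType) (V W : lmodType R[i]) (p : V -> R)
    (p_subadd : forall x y, p (x + y) <= p x + p y)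
    (p_homog : forall (c : R[i]) x, (p (c *: x))%:C = `|c| * (p x)%:C)
    (I : eqType) (E : I -> set W) (phi : I -> W -> V) (psi : I -> W -> R[i]^o) (M : R) :
  (forall i, subspace_closed (E i)) -> (forall i, linear (phi i)) ->
  (forall i, linear (psi i)) -> 0 <= M ->
  (forall n (i : 'I_n -> I) (w : 'I_n -> W), injective i -> (forall j, E (i j) (w j)) ->
     `|\sum_(j < n) psi (i j) (w j)| <= M%:C * (p (\sum_(j < n) phi (i j) (w j)))%:C) ->
  exists f : V -> R[i]^o, [/\ linear f, forall x, `|f x| <= (2 * M)%:C * (p x)%:C
    & forall i w, E i w -> f (phi i w) = psi i w].
Proof.
move=> Esub phil psil M0 bd.
(* The prescribed functional on the sum of the images, as a graph of finite sums over distinct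
   indices. The bound [bd] makes it dominated; sums with different supports are added after padding
   with zeros. *)
pose G := [set u : V * R[i] | exists s : seq I, exists2 w : I -> W,
  uniq s /\ (forall i, E i (w i)) &
  u = (\sum_(i <- s) phi i (w i), \sum_(i <- s) psi i (w i))].
have E0 i : E i 0 by case: (Esub i).
have ED i c x y : E i x -> E i y -> E i (c *: x + y) by case: (Esub i) => _; exact.
have [|||c u v [s [w [us Ew] ->]] [t [z [ut Ez] ->]]|u [s [w [us Ew] ->]]/=|f [lf fM fG]] :=
    @complex_Hahn_Banach R V (fun x => M * p x) _ _ G.
- by move=> x y; rewrite -mulrDr ler_wpM2l.
- by move=> c x; rewrite !realcM p_homog mulrCA.
- by exists [::], (fun=> 0) => //; rewrite !big_nil.
- pose w' i := c *: (if i \in s then w i else 0) + (if i \in t then z i else 0).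
  exists (undup (s ++ t)), w'.
    split; first exact: undup_uniq.
    by move=> i; apply: ED; case: ifP.
  have sum (U : lmodType R[i]) (F : I -> W -> U) : (forall i, linear (F i)) ->
      \sum_(i <- undup (s ++ t)) F i (w' i) =
      c *: \sum_(i <- s) F i (w i) + \sum_(i <- t) F i (z i).
    move=> lF.
    rewrite -(@big_if_mem _ _ (undup (s ++ t)) s) ?undup_uniq//; last first.
      by move=> i si; rewrite mem_undup mem_cat si.
    rewrite -(@big_if_mem _ _ (undup (s ++ t)) t) ?undup_uniq//; last first.
      by move=> i si; rewrite mem_undup mem_cat si orbT.
    rewrite scaler_sumr -big_split; apply: eq_bigr => i _ /=.
    by rewrite lF; congr (_ *: _ + _); case: ifP => // _; exact: linear_zero.
  by rewrite (sum _ phi)// (sum _ psi).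
- rewrite [leRHS]realcM [X in `|X|]big_tnth [X in p X]big_tnth.
  by apply: bd => //; exact/tuple_uniqP.
exists f; split=> // [x|i w Ew].
  by rewrite (le_trans (fM x))// (realcM M) (realcM 2) mulrA rmorph_nat.
pose w' j := if j == i then w else 0.
have := fG (phi i w, psi i w); apply; exists [:: i], w'; last first.
  by rewrite !big_seq1 /w' eqxx.
by split=> // j; rewrite /w'; case: eqP => // ->.
Qed.

Section RealNorm.
Variables (R : realType) (V : normedModType R[i]).

Lemma rnormD (x y : V) : rnorm (x + y) <= rnorm x + rnorm y.
Proof. by rewrite -lecR realcD !rnormE ler_normD. Qed.

Lemma bounded_set_rnorm (X : set V) : bounded_set X ->
  exists2 M : R, 0 <= M & forall x, X x -> `|x| <= M%:C.
Proof.
move=> [M [Mreal MX]].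
have {}MX N : M < N -> forall x, X x -> `|x| <= N by exact: MX.
have ME : M = (complex.Re M)%:C by rewrite RRe_real.
exists (`|complex.Re M| + 1) => [|x Xx]; first by rewrite addr_ge0.
apply: MX => //; rewrite ME ltcR (le_lt_trans (ler_norm _))//.
by rewrite ltrDl.
Qed.

End RealNorm.

Section L1Product.
Variables (R : realType) (A : normedModType R[i]) (m : nat).

Definition l1norm (v : {ffun 'I_m -> A}) : R := \sum_(k < m) rnorm (v k).

Lemma l1normE v : (l1norm v)%:C = \sum_(k < m) `|v k|.
Proof. by rewrite /l1norm rmorph_sum; apply: eq_bigr => k _; exact: rnormE. Qed.

Lemma l1norm_subadd x y : l1norm (x + y) <= l1norm x + l1norm y.
Proof. by rewrite -big_split ler_sum// => k _; rewrite ffunE rnormD. Qed.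

Lemma l1norm_homog (c : R[i]) x : (l1norm (c *: x))%:C = `|c| * (l1norm x)%:C.
Proof. by rewrite !l1normE mulr_sumr; apply: eq_bigr => k _; rewrite ffunE normrZ. Qed.

(** The dual of [A ^ m] is the [m]-th power of the dual of [A], through the coordinate embeddings
    [inj k]. *)
Lemma l1product_functional (f : {ffun 'I_m -> A} -> R[i]^o) (M : R) : linear f ->
  (forall x, `|f x| <= M%:C * (l1norm x)%:C) ->
  exists S : 'I_m -> dual A, forall v, f v = \sum_(k < m) S k (v k).
Proof.
move=> lf fM.
pose inj k (x : A) : {ffun 'I_m -> A} := [ffun j => if j == k then x else 0].
have bf k : bounded_functional (fun x => f (inj k x)).
  split=> [c x y|].
    rewrite -lf; congr f; apply/ffunP => j; rewrite !ffunE.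
    by case: eqP => // _; rewrite scaler0 addr0.
  exists M => x; rewrite (le_trans (fM _))// l1normE (bigD1 k)//= ffunE eqxx.
  by rewrite big1 ?addr0// => j /negPf jk; rewrite ffunE jk normr0.
exists (fun k => mk_dual (bf k)) => v /=.
rewrite -linear_sum_fun//; congr f; apply/ffunP => j.
rewrite sum_ffunE (bigD1 j)//= ffunE eqxx big1 ?addr0// => k /negPf kj.
by rewrite ffunE eq_sym kj.
Qed.

End L1Product.

(** * Interpolation on bases of the three types *)

Section Interpolation.
Variables (R : realType) (A : banachAlgType R).
Variables (d : Order.disp_t) (eta : orderType d).
Implicit Types (Aa : eta -> set A) (T : dual A) (U : set eta).

Lemma Fl1_base2_base3 Aa (a : eta -> 'I_1 -> A -> A) :
  Fl1_base2 Aa (a^~ ord0) -> Fl1_base3 Aa a.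
Proof.
move=> [[Az [amul [M aM]] adisj] [Lbd L0 Ldisj Lsel] [K2 K20 aK2]].
have LE : (fun x => \bigcup_k (a x k @` Aa x)) = (fun x => a x ord0 @` Aa x).
  apply/funext => x; apply/seteqP; split=> [y [k _]|y Ly]; last by exists ord0.
  by rewrite (ord1 k).
split=> //.
- split=> [[x k]|]; first by rewrite (ord1 k).
  by exists M => -[x k] b; rewrite (ord1 k).
- by move=> k; rewrite (ord1 k).
- by rewrite LE.
- by exists K2 => // x b /aK2; rewrite big_ord1.
Qed.

(** Here the indices are the pairs [(x, b)] and each carries the scalar line, so a value is
    prescribed at each base element separately. As the [b] are bounded by [B], the values are at
    most [rnorm T * B], and the constant [K] of the base turns this into a bound on the
    functional. *)
Lemma Fl1_base1_interpolation Aa (a : eta -> 'I_1 -> A -> A) T U :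
  Fl1_base1 Aa (a^~ ord0) ->
  exists S : 'I_1 -> dual A, forall x b, Aa x b ->
    \sum_(k < 1) S k (a x k b) = if x \in U then T b else 0.
Proof.
move=> [[[_ Abd _] _ _] [_ _ [K K0 Kl1]]].
have [B B0 AB] := bounded_set_rnorm Abd.
pose D := [set xb : eta * A | Aa xb.1 xb.2].
pose phi (i : {xb | xb \in D}) (z : R[i]^o) : {ffun 'I_1 -> A} :=
  [ffun k => z *: a (val i).1 k (val i).2].
pose c (i : {xb | xb \in D}) : R[i]^o := if (val i).1 \in U then T (val i).2 else 0.
pose psi i (z : R[i]^o) : R[i]^o := z *: c i.
have TB i : `|c i| <= (rnorm T * B)%:C.
  rewrite /c; case: ifP => _; last by rewrite normr0 ler0c mulr_ge0 ?rnorm_ge0.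
  rewrite (le_trans (dual_bound _ _))// realcM rnormE ler_wpM2l//.
  by case: i => xb /= xbD; apply: AB; exists xb.1 => //; exact: (set_mem xbD).
have [|i|i||n i z iinj _|f [lf fM fphi]] := @selective_interpolation R _ R[i]^o
  (@l1norm R A 1) (@l1norm_subadd _ _ _) (@l1norm_homog _ _ _) _ (fun=> setT) phi psi
  (rnorm T * B * K).
- by [].
- by move=> z x y; apply/ffunP => k; rewrite !ffunE scalerDl scalerA.
- by move=> z x y; rewrite /psi scalerDl scalerA.
- by rewrite !mulr_ge0 ?rnorm_ge0// ltW.
- rewrite l1normE big_ord1 sum_ffunE.
  rewrite (eq_bigr (fun j => z j *: a (val (i j)).1 ord0 (val (i j)).2)); last first.
    by move=> j _; rewrite ffunE.
  have /(ler_wpM2l _)/le_trans := Kl1 n (fun j => val (i j)) z (inj_comp val_inj iinj)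
    (fun j => set_mem (valP (i j))).
  rewrite realcM -mulrA => h.
  apply: le_trans (h (rnorm T * B)%:C _ _ (lexx _)); last by rewrite ler0c mulr_ge0 ?rnorm_ge0.
  rewrite (le_trans (ler_norm_sum _ _ _))// mulr_sumr ler_sum// => j _.
  by rewrite normrZ mulrC ler_wpM2r.
have [S fS] := l1product_functional lf fM.
exists S => x b xb.
have xbD : (x, b) \in D by exact: mem_set.
have := fphi (Sub (x, b) xbD) 1 I; rewrite /psi /c /= scale1r => <-.
by rewrite fS; apply: eq_bigr => k _; rewrite ffunE scale1r.
Qed.

(** The indices are now the [x], each carrying the span of [Aa x], mapped to [A ^ m] by [phi x].
    [K2] controls [T b] by this image, and [K1], applied in each coordinate [k], controls sums over
    distinct [x]. *)
Lemma Fl1_base3_interpolation m Aa (a : eta -> 'I_m -> A -> A) T U :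
  Fl1_base3 Aa a ->
  exists S : 'I_m -> dual A, forall x b, Aa x b ->
    \sum_(k < m) S k (a x k b) = if x \in U then T b else 0.
Proof.
move=> [_ [amul _] _ [_ _ _ [K1 K10 Lsel]] [K2 K20 aK2]].
have alin x k : linear (a x k) by have [] := amul (x, k).
pose phi x (b : A) : {ffun 'I_m -> A} := [ffun k => a x k b].
pose psi x (b : A) : R[i]^o := if x \in U then T b else 0.
have [x|x|x||n i w iinj iw|f [lf fM fphi]] := @selective_interpolation R _ A
  (@l1norm R A m) (@l1norm_subadd _ _ _) (@l1norm_homog _ _ _) _
  (fun x => lspan (Aa x)) phi psi (rnorm T * K2 * K1).
- exact: lspan_subspace.
- by move=> c b b'; apply/ffunP => k; rewrite !ffunE alin.
- by move=> c b b'; rewrite /psi; case: ifP => _; [rewrite linearP|rewrite scaler0 addr0].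
- by rewrite !mulr_ge0 ?rnorm_ge0// ltW.
- rewrite l1normE (le_trans (ler_norm_sum _ _ _))//.
  apply: (@le_trans _ _ (\sum_(j < n) (rnorm T * K2)%:C * \sum_(k < m) `|a (i j) k (w j)|)).
    apply: ler_sum => j _; rewrite /psi; case: ifP => _; last first.
      by rewrite normr0 mulr_ge0 ?sumr_ge0// ler0c mulr_ge0 ?rnorm_ge0// ltW.
    rewrite (le_trans (dual_bound _ _))// realcM rnormE -mulrA ler_wpM2l//.
    exact: aK2.
  rewrite -mulr_sumr (realcM _ K1) -mulrA ler_wpM2l//.
    by rewrite ler0c mulr_ge0 ?rnorm_ge0// ltW.
  rewrite exchange_big mulr_sumr ler_sum// => k _.
  rewrite sum_ffunE; under [in leRHS]eq_bigr do rewrite ffunE.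
  apply: (Lsel n i) => // j.
  have sub : a (i j) k @` Aa (i j) `<=` \bigcup_l (a (i j) l @` Aa (i j)).
    by move=> y Ly; exists k.
  exact: (lspan_le sub (linear_image_lspan (alin _ k) (iw j))).
have [S fS] := l1product_functional lf fM.
exists S => x b xb.
have := fphi x b (lspan_sub xb); rewrite /psi => <-.
by rewrite fS; apply: eq_bigr => k _; rewrite ffunE.
Qed.

Lemma Fl1_base_interpolation m Aa (a : eta -> 'I_m -> A -> A) T U :
  Fl1_base Aa a ->
  exists S : 'I_m -> dual A, forall x b, Aa x b ->
    \sum_(k < m) S k (a x k b) = if x \in U then T b else 0.
Proof.
case=> [[m1]|[m1]|].
- by subst m => /(_ ord0)/Fl1_base1_interpolation; exact.
- by subst m => /(_ ord0)/Fl1_base2_base3/Fl1_base3_interpolation; exact.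
- exact: Fl1_base3_interpolation.
Qed.

End Interpolation.

(** * Cluster points *)

Section UltrafilterLimits.
Variables (R : realType) (I : Type) (p : set_system I).
Hypothesis pU : UltraFilter p.

(** Compactness of [[- M, M]] gives a cluster point [l]. The ultrafilter contains the preimage of
    each ball around [l] or its complement, and the complement would contradict clustering. *)
Lemma ultra_cvg_bounded_real (h : I -> R) (M : R) : (forall i, `|h i| <= M) ->
  exists l : R, forall eps, 0 < eps -> p [set i | `|l - h i| < eps].
Proof.
move=> hM; have pF : ProperFilter p by exact: ultra_proper.
have hp : p [set i | `[- M, M]%classic (h i)].
  by apply: filterE => i; rewrite /= in_itv /= -ler_norml hM.
have [l [_ lcl]] := @segment_compact R (- M) M (h @ p) _ hp.
exists l => eps e0.
have [//|pC] := in_ultra_setVsetC [set i | `|l - h i| < eps] pU.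
have [|y [/=]] := lcl [set y | ~ `|l - y| < eps] (ball l eps) _ (nbhsx_ballx l eps e0).
  exact: pC.
by rewrite -ball_normE.
Qed.

Lemma ultra_cvg_bounded (g : I -> R[i]^o) (M : R) : (forall i, `|g i| <= M%:C) ->
  exists z : R[i]^o, g i @[i --> p] --> z.
Proof.
move=> gM; have pF : ProperFilter p by exact: ultra_proper.
have [i|x xP] := @ultra_cvg_bounded_real (fun i => complex.Re (g i)) M.
  by rewrite -lecR (le_trans (normc_ge_Re _))// gM.
have [i|y yP] := @ultra_cvg_bounded_real (fun i => complex.Im (g i)) M.
  rewrite -lecR (le_trans _ (gM i))// normc_def lecR -sqrtr_sqr ler_sqrt ?addr_ge0 ?sqr_ge0//.
  by rewrite lerDr sqr_ge0.
exists (x +i* y); apply/cvgrPdist_lt => eps e0.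
have epsE : eps = (complex.Re eps)%:C by rewrite RRe_real// ger0_real// ltW.
have e2 : 0 < complex.Re eps / 2 by rewrite divr_gt0// -ltcR -epsE.
have pFilter : Filter p by exact: filter_filter.
have pxy := @filterI _ _ pFilter _ _ (xP _ e2) (yP _ e2).
change (p [set t | `|((x +i* y)%C : R[i]^o) - g t| < eps]).
apply: (@filterS I p pFilter _ _ _ pxy) => i [/= xi yi].
rewrite [X in `|X|]complexE (le_lt_trans (ler_normD _ _))//.
rewrite normrM normr_i mul1r !normr_realc -realcD epsE ltcR (splitr (complex.Re eps)) ltrD//.
  by move: xi; case: (g i).
by move: yi; case: (g i).
Qed.

End UltrafilterLimits.

Section WeakStarLimits.
Variables (R : realType) (V : normedModType R[i]) (I : Type).
Implicit Types (F p : set_system I) (f : I -> dual V) (l : dual V).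

Lemma complex_cvg_unique F (g : I -> R[i]^o) (z z' : R[i]^o) : ProperFilter F ->
  g i @[i --> F] --> z -> g i @[i --> F] --> z' -> z = z'.
Proof. by move=> FF; apply: (@cvg_unique _ (@norm_hausdorff _ _)). Qed.

Lemma complex_cvg_norm_le F (g : I -> R[i]^o) (z : R[i]^o) (M : R[i]) : ProperFilter F ->
  M \is Num.real -> (forall i, `|g i| <= M) -> g i @[i --> F] --> z -> `|z| <= M.
Proof.
move=> FF Mr gM /cvgrPdist_lt gz; rewrite real_leNgt ?normr_real//; apply/negP => Mz.
have : 0 < `|z| - M by rewrite subr_gt0.
move=> /gz/filter_ex[i /= zi]; have : `|z| < `|z|; last by rewrite ltxx.
rewrite -{1}(subrK (g i) z) (le_lt_trans (ler_normD _ _))// -ltrBrDr.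
by rewrite (lt_le_trans zi)// lerB.
Qed.

Lemma complex_cvg_sum F n (g : 'I_n -> I -> R[i]^o) (z : 'I_n -> R[i]^o) : Filter F ->
  (forall k, g k i @[i --> F] --> z k) ->
  \sum_(k < n) g k i @[i --> F] --> \sum_(k < n) z k.
Proof.
move=> FF; elim: n g z => [|n IH] g z gz.
  rewrite big_ord0 (_ : (fun i => _) = fun=> 0); first exact: cvg_cst.
  by apply/funext => i; rewrite big_ord0.
rewrite big_ord_recl; under eq_fun do rewrite big_ord_recl.
by apply: cvgD (gz ord0) _; apply: IH => k; exact: gz.
Qed.

Lemma weakstar_lim_cvg F f l : weakstar_cvg F f l -> weakstar_cvg F f (weakstar_lim F f).
Proof. by move=> fl; apply: (@xgetI _ 0 [set l | weakstar_cvg F f l] l). Qed.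

Lemma weakstar_cvg_norm_le F f l (M : R) : ProperFilter F -> 0 <= M ->
  (forall i, `|f i| <= M%:C) -> weakstar_cvg F f l -> `|l| <= M%:C.
Proof.
move=> FF M0 fM fl; apply: dual_norm_mk => // x.
apply: complex_cvg_norm_le (fl x) => [|i].
  by rewrite realM ?normr_real// complex_real.
by rewrite (le_trans (dual_bound _ _))// ler_wpM2r.
Qed.

(** Banach-Alaoglu along an ultrafilter: the pointwise limits exist and form a bounded linear
    functional. *)
Lemma ultra_weakstar_cvg p f (M : R) : UltraFilter p ->
  (forall i, `|f i| <= M%:C) -> exists l : dual V, weakstar_cvg p f l.
Proof.
move=> pU fM; have pF : ProperFilter p by exact: ultra_proper.
have fxM x i : `|f i x| <= (M * rnorm x)%:C.
  by rewrite (le_trans (dual_bound _ _))// realcM rnormE ler_wpM2r.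
have /choice[l lP] : forall x, exists z : R[i]^o, f i x @[i --> p] --> z.
  by move=> x; exact: ultra_cvg_bounded (fxM x).
have bl : bounded_functional l.
  split=> [c x y|].
    apply: (complex_cvg_unique pF (lP _)).
    under eq_fun do rewrite linearP.
    by apply: cvgD (lP y); apply: cvgZl_tmp; exact: lP.
  exists M => x; rewrite -(rnormE x) -realcM.
  by apply: complex_cvg_norm_le (lP x) => //; rewrite complex_real.
by exists (mk_dual bl) => x; exact: lP.
Qed.

End WeakStarLimits.

Section DualDensity.
Variables (R : realType) (V : normedModType R[i]).

Lemma dual_eq0_dense (E : set V) (h : dual V) :
  closure (lspan E) = setT -> (forall b, E b -> h b = 0) -> h = 0.
Proof.
move=> Edense hE; apply: dualP => b.
have h0 x : lspan E x -> h x = 0.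
  move=> [n [c [v [Ev ->]]]]; rewrite (linear_sum_fun _ _ (dual_linear h)) big1// => i _.
  have -> : h (c i *: v i) = c i *: h (v i) by exact: linearZ.
  by rewrite hE// scaler0.
apply/eqP; rewrite -[X in _ == X]/(0 : R[i]) -normr_le0 real_leNgt ?normr_real//.
apply/negP => hb.
have h1 : 0 < `|h| + 1 by rewrite ltr_wpDl.
have : closure (lspan E) b by rewrite Edense.
move=> /closure_normP/(_ _ (divr_gt0 hb h1))[y /h0 hy by_].
have : `|h b| < `|h b|; last by rewrite ltxx.
rewrite -{1}[b](subrK y) linearD /= hy addr0 (le_lt_trans (dual_bound _ _))//.
rewrite (@le_lt_trans _ _ ((`|h| + 1) * `|b - y|))//.
  by rewrite ler_wpM2r// lerDl.
by rewrite mulrC -ltr_pdivlMr.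
Qed.

Lemma dual_eq_dense (E : set V) (f g : dual V) :
  closure (lspan E) = setT -> (forall b, E b -> f b = g b) -> f = g.
Proof.
move=> Edense fg; apply/eqP; rewrite -subr_eq0; apply/eqP.
apply: dual_eq0_dense Edense _ => b /fg fgb.
by rewrite -[LHS]/(f b - g b) fgb subrr.
Qed.

Lemma dual_sumE n (f : 'I_n -> dual V) x :
  (\sum_(k < n) f k) x = \sum_(k < n) f k x.
Proof. exact: (big_morph (fun f : dual V => f x)). Qed.

End DualDensity.

(** * Right multipliers and their cluster points in LUC(A)^* *)

Section Multipliers.
Variables (R : realType) (A : banachAlgType R).
Variables (J : Type) (leJ : J -> J -> Prop) (e : J -> A).
Hypothesis he : bounded_approximate_identity leJ e.

Lemma net_filter_proper : ProperFilter (net_filter leJ).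
Proof.
have [[[i0] lexx letr ledir] _ _ _] := he.
apply: Build_ProperFilter_ex => [U [i Ui]|]; first by exists i; exact: Ui.
split; first by exists i0.
- move=> U V [i Ui] [j Vj]; have [k [ik jk]] := ledir i j.
  by exists k => l kl; split; [apply: Ui|apply: Vj]; exact: letr kl.
- by move=> U V UV [i Ui]; exists i => j /Ui/UV.
Qed.

Lemma bai_bound : exists2 B : R, 0 <= B & forall j, `|e j| <= B%:C.
Proof.
have [_ /bounded_set_rnorm[B B0 eB] _ _] := he.
by exists B => // j; apply: eB; exists j.
Qed.

Lemma bai_right a (eps : R[i]) : 0 < eps ->
  net_filter leJ [set j | `|a - a ** e j| < eps].
Proof.
have [_ _ _ /(_ a)] := he => ae e0.
have netF : Filter (net_filter leJ) by exact: (@filter_filter _ _ net_filter_proper).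
by move/cvgrPdist_lt : ae; apply.
Qed.

Lemma dact_net_cvg (T : A -> A) (M : R) (S : dual A) a : right_multiplier T ->
  (forall a, `|T a| <= M%:C * `|a|) ->
  dact S a (T (e j)) @[j --> net_filter leJ] --> (S (T a) : R[i]^o).
Proof.
move=> [Tlin _ Tmul] TM.
have netF : Filter (net_filter leJ) by exact: (@filter_filter _ _ net_filter_proper).
apply/cvgrPdist_lt => eps e0.
have C0 : 0 < `|S| * `|M|%:C + 1 by rewrite ltr_wpDl// mulr_ge0// lecR.
change (net_filter leJ [set j | `|(S (T a) : R[i]^o) - dact S a (T (e j))| < eps]).
apply: (@filterS _ _ netF _ _ _ (bai_right a (divr_gt0 e0 C0))) => j /= aj.
rewrite -Tmul.
have -> : S (T a) - S (T (a ** e j)) = S (T (a - a ** e j)).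
  by rewrite -linearB addrC -scaleN1r -Tlin scaleN1r [- _ + _]addrC.
rewrite (le_lt_trans (dual_bound _ _))//.
apply: (@le_lt_trans _ _ ((`|S| * `|M|%:C + 1) * `|a - a ** e j|)).
  rewrite mulrDl mul1r -mulrA; apply: (@le_trans _ _ (`|S| * (`|M|%:C * `|a - a ** e j|))).
    by rewrite ler_wpM2l// (le_trans (TM _))// ler_wpM2r// lecR ler_norm.
  by rewrite lerDl.
by rewrite mulrC -ltr_pdivlMr.
Qed.

(* Convergence is checked on the generators [S . a], where
   [S (a ** T (e j)) = S (T (a ** e j))], and extended by boundedness. *)
Lemma luc_multiplier_cvg (T : A -> A) (M : R) : right_multiplier T ->
  (forall a, `|T a| <= M%:C * `|a|) ->
  weakstar_cvg (net_filter leJ) (fun j => luc_eval (T (e j))) (luc_multiplier leJ e T).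
Proof.
move=> Tm TM; have netP := net_filter_proper.
have netF : Filter (net_filter leJ) by exact: (@filter_filter _ _ netP).
have [B B0 eB] := bai_bound.
(* The candidate limit [l] is taken along an ultrafilter finer than the net. On the span of the
   generators the whole net converges, necessarily to [l]; density and the common bound carry this
   over to LUC(A). *)
have [G [GU netG]] := ultraFilterLemma netP.
have GF : ProperFilter G by exact: ultra_proper.
have TeB j : `|T (e j)| <= (`|M| * B)%:C.
  rewrite (le_trans (TM _))// realcM (@le_trans _ _ (`|M|%:C * `|e j|))//.
    by rewrite ler_wpM2r// lecR ler_norm.
  by rewrite ler_wpM2l// lecR.
have MB0 : 0 <= `|M| * B by rewrite mulr_ge0.
have evB (a : A) : `|luc_eval a| <= `|a|.
  rewrite -(rnormE a); apply: dual_norm_mk => [|S]; first exact: rnorm_ge0.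
  by rewrite rnormE mulrC; exact: (dual_bound (lucval S) a).
have fM j : `|luc_eval (T (e j))| <= (`|M| * B)%:C by rewrite (le_trans (evB _)).
have [l lG] := ultra_weakstar_cvg GU fM.
have lM : `|l| <= (`|M| * B)%:C by exact: weakstar_cvg_norm_le lG.
pose gen := [set dact S a | S in [set: dual A] & a in [set: A]].
have conv (S : dual A) : lspan gen S ->
    exists z : R[i]^o, S (T (e j)) @[j --> net_filter leJ] --> z.
  apply: (@lspan_min _ _ _ [set S : dual A |
    exists z : R[i]^o, S (T (e j)) @[j --> net_filter leJ] --> z]).
    split=> [|c U U' [z Uz] [z' Uz']].
      by exists 0; apply: cvg_cst.
    by exists (c *: z + z'); apply: cvgD Uz'; exact: cvgZl_tmp.
  by move=> _ [U _ [a _ <-]]; exists (U (T a)); exact: dact_net_cvg TM.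
apply: (@weakstar_lim_cvg _ _ _ _ _ l) => S; apply/cvgrPdist_lt => eps e0.
pose C : R[i] := (`|M| * B)%:C.
have C0 : 0 <= C by rewrite lecR.
have C1 : 0 < C + C + 1 by rewrite ltr_wpDl// addr_ge0.
have e2 : 0 < eps / 2 by rewrite divr_gt0.
have /closure_normP/(_ _ (divr_gt0 e2 C1))[S0 S0gen SS0] := @luc_inP _ _ S.
pose s0 : LUC A := mk_luc (subset_closure S0gen).
have [z S0z] := conv _ S0gen.
have S0l : S0 (T (e j)) @[j --> net_filter leJ] --> (l s0 : R[i]^o).
  suff -> : l s0 = z by [].
  apply: (complex_cvg_unique GF (lG s0)).
  exact: cvg_trans (cvg_app _ netG) S0z.
move/cvgrPdist_lt/(_ _ e2) : S0l => S0l.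
apply: (@filterS _ _ netF _ _ _ S0l) => j /= S0j.
have SS0l : `|S - s0| < eps / 2 / (C + C + 1) by [].
have dist (u : dual (LUC A)) : `|u| <= C -> `|u (S - s0)| <= C * `|S - s0|.
  by move=> uC; rewrite (le_trans (dual_bound _ _))// ler_wpM2r.
have -> : l S - luc_eval (T (e j)) S =
    l (S - s0) + (l s0 - luc_eval (T (e j)) s0) - luc_eval (T (e j)) (S - s0).
  rewrite [l (S - s0)]linearB [luc_eval _ (S - s0)]linearB.
  by rewrite addrA subrK opprB addrA subrK.
rewrite (le_lt_trans (ler_normB _ _))//.
rewrite (le_lt_trans (lerD (ler_normD _ _) (lexx _)))//.
rewrite addrAC [ltRHS]splitr ler_ltD//.
rewrite (le_trans (lerD (dist l lM) (dist _ (fM j))))// -mulrDl.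
rewrite (@le_trans _ _ ((C + C + 1) * `|S - s0|))//.
  by rewrite ler_wpM2r// lerDl.
by rewrite mulrC -ler_pdivlMr// ltW.
Qed.

Lemma luc_multiplierE (T : A -> A) (M : R) S a : right_multiplier T ->
  (forall a, `|T a| <= M%:C * `|a|) ->
  luc_multiplier leJ e T (luc_act S a) = S (T a).
Proof.
move=> Tm TM; have netP := net_filter_proper.
have cvg1 := @luc_multiplier_cvg _ _ Tm TM (luc_act S a).
have cvg2 : luc_eval (T (e j)) (luc_act S a) @[j --> net_filter leJ] --> (S (T a) : R[i]^o).
  exact: dact_net_cvg TM.
exact: (complex_cvg_unique netP cvg1 cvg2).
Qed.

(** The bound depends on the multiplier only through [M], so the bounded family of base multipliers
    stays bounded in LUC(A)^* and has limits along ultrafilters. *)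
Lemma luc_multiplier_norm : exists2 B : R, 0 <= B &
  forall (T : A -> A) (M : R), right_multiplier T -> 0 <= M ->
    (forall a, `|T a| <= M%:C * `|a|) -> `|luc_multiplier leJ e T| <= (M * B)%:C.
Proof.
have [B B0 eB] := bai_bound; exists B => // T M Tm M0 TM.
have MB0 : 0 <= M * B by rewrite mulr_ge0.
apply: (weakstar_cvg_norm_le net_filter_proper MB0 _ (luc_multiplier_cvg Tm TM)) => j.
apply: dual_norm_mk => // S; rewrite (le_trans (dual_bound (lucval S) (T (e j))))//.
rewrite mulrC ler_wpM2r// (le_trans (TM _))// realcM ler_wpM2l// lecR//.
Qed.

Variables (d : Order.disp_t) (eta : orderType d) (m : nat).
Variables (Aa : eta -> set A) (a : eta -> 'I_m -> A -> A).
Hypothesis base : Fl1_base Aa a.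

Lemma Fl1_base_multipliers :
  (forall x k, right_multiplier (a x k)) /\
  exists2 M : R, 0 <= M & forall x k b, `|a x k b| <= M%:C * `|b|.
Proof.
have [amul [M aM]] : bounded_right_multipliers (fun xk : eta * 'I_m => a xk.1 xk.2).
  case: base => [[m1 h]|[m1 h]|[]//].
    subst m; have [[_ [amul [M aM]] _] _] := h ord0.
    split=> [[x k]|]; first by rewrite (ord1 k).
    by exists M => -[x k] b; rewrite (ord1 k).
  subst m; have [[_ [amul [M aM]] _] _ _] := h ord0.
  split=> [[x k]|]; first by rewrite (ord1 k).
  by exists M => -[x k] b; rewrite (ord1 k).
split=> [x k|]; first exact: (amul (x, k)).
exists `|M| => // x k b; rewrite (le_trans (aM (x, k) b))// ler_wpM2r// lecR.
exact: ler_norm.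
Qed.

Lemma Fl1_base_zooming : (0 < m)%N -> zooming_family Aa.
Proof.
by case: base => [[m1 h]|[m1 h]|[]//] _; subst m; have [[]] := h ord0.
Qed.

(** Makes [cluster_point] a genuine weak-star limit rather than the default value of
    [weakstar_lim]. *)
Lemma cluster_point_cvg (p : set_system eta) k : UltraFilter p ->
  weakstar_cvg p (fun x => luc_multiplier leJ e (a x k)) (cluster_point leJ e a p k).
Proof.
move=> pU; have [amul [M M0 aM]] := Fl1_base_multipliers.
have [B B0 lB] := luc_multiplier_norm.
have fM x : `|luc_multiplier leJ e (a x k)| <= (M * B)%:C by exact: lB.
by have [l pl] := ultra_weakstar_cvg pU fM; exact: weakstar_lim_cvg pl.
Qed.

(** An ultrafilter contains the final segment or its complement, and the complement is not
    cofinal. *)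
Lemma cofinal_ultrafilter_tail (p : set_system eta) (x : eta) :
  cofinal_ultrafilters eta p -> p [set y | (x <= y)%O].
Proof.
move=> [pU pcof]; have [//|pC] := in_ultra_setVsetC [set y | (x <= y)%O] pU.
by have [y /= nxy xy] := pcof _ pC x; case: nxy.
Qed.

(* For [b] in [Aa x], the values along [p] are eventually constant. *)
Lemma cluster_point_act (T : dual A) (U : set eta) (S : 'I_m -> dual A)
    (p : set_system eta) : (0 < m)%N -> cofinal_ultrafilters eta p ->
  (forall x b, Aa x b -> \sum_(k < m) S k (a x k b) = if x \in U then T b else 0) ->
  \sum_(k < m) luc_dual_act (cluster_point leJ e a p k) (S k) =
    if `[< p U >] then T else 0.
Proof.
move=> m0 pcof SE; have [pU _] := pcof.
have pF : ProperFilter p by exact: ultra_proper.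
have pFilter : Filter p by exact: (@filter_filter _ _ pF).
have [amul [M M0 aM]] := Fl1_base_multipliers.
have [Amono _ Adense] := Fl1_base_zooming m0.
apply: dual_eq_dense Adense _ => b [x _ Axb].
rewrite dual_sumE.
have cvg1 : \sum_(k < m) luc_multiplier leJ e (a y k) (luc_act (S k) b) @[y --> p]
    --> (\sum_(k < m) cluster_point leJ e a p k (luc_act (S k) b) : R[i]^o).
  by apply: complex_cvg_sum => k; exact: (@cluster_point_cvg p k pU).
apply: (complex_cvg_unique pF cvg1); apply: cvg_near_cst.
(* The sets [Aa] increase, so [b] lies in [Aa y] and the interpolation identity holds at every [y]
   above [x]. *)
have mulE y : (x <= y)%O -> \sum_(k < m) luc_multiplier leJ e (a y k) (luc_act (S k) b) =
    if y \in U then T b else 0.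
  move=> xy; rewrite -(SE y b); last exact: (Amono x y xy b).
  by apply: eq_bigr => k _; exact: luc_multiplierE (aM y k).
have tail := cofinal_ultrafilter_tail x pcof.
case: asboolP => pUU.
  apply: (@filterS _ p pFilter _ _ _ (@filterI _ p pFilter _ _ tail pUU)) => y [xy Uy].
  by rewrite mulE// mem_set.
have [//|pCU] := in_ultra_setVsetC U pU.
apply: (@filterS _ p pFilter _ _ _ (@filterI _ p pFilter _ _ tail pCU)) => y [xy Uy].
by rewrite mulE// memNset.
Qed.

End Multipliers.

(** * Right ideals *)

(** Of two distinct ultrafilters neither contains the other, by maximality. So for [j] other than
    [i] some set lies in [p i] and not in [p j], and [U i] is the finite intersection of these over
    [j]. *)
Lemma separating_ultrafilter_sets (I : Type) n (p : 'I_n -> set_system I) :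
  (forall i, UltraFilter (p i)) -> injective p ->
  exists U : 'I_n -> set I, forall i j, p j (U i) <-> i = j.
Proof.
move=> pU pinj.
have pP i : ProperFilter (p i) by exact: ultra_proper.
have pF i : Filter (p i) by exact: (@filter_filter _ _ (pP i)).
have /choice[U UP] : forall ij : 'I_n * 'I_n, exists U, p ij.1 U /\
    (ij.1 <> ij.2 -> ~ p ij.2 U).
  move=> [i j] /=; have [<-|/eqP ij] := eqVneq i j.
    by exists setT; split=> //; exact: filterT.
  apply: contrapT => /forallNP nU; apply: ij; apply: pinj.
  apply/esym/max_filter => U piU; apply: contrapT => npjU.
  by apply: (nU U).
exists (fun i => [set x | forall j, U (i, j) x]) => i j; split=> [pj|<-].
  apply: contrapT => ij; apply: (UP (i, j)).2 ij _.
  by apply: (@filterS _ _ (pF j) _ _ _ pj) => x; apply.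
by apply: filter_forall => k; exact: (UP (i, k)).1.
Qed.

Section RightIdeals.
Variables (K : fieldType) (V : lmodType K) (mul : V -> V -> V).
Hypothesis mul_linear : forall x, linear (mul x).

(** In a general ideal, the products with a single nonzero [x] of the ideal are used, and the
    dimension is bounded inside the ideal itself, without comparing it with the principal ideal. *)
Lemma right_ideals_dim_ge_of_dual_systems (S : set V) (T : Type) m (v : T -> 'I_m -> V) :
  subalgebra mul S -> (forall t k, S (v t k)) -> infinite_set [set: T] ->
  (forall x, S x -> x <> 0 -> has_dual_systems (fun t k => mul x (v t k))) ->
  right_ideals_dim_ge mul S T.
Proof.
move=> [[S0 SD] Smul] Sv Tinf vsep; split=> [x Sx x0|I [IS [I0 ID] Imul] Ine].
  apply: (dim_ge_of_dual_systems (vsep x Sx x0)) => // [|t k]; last by exists (v t k).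
  split; first by exists 0 => //; exact: (linear_zero (mul_linear x)).
  by move=> c _ _ [y Sy <-] [z Sz <-]; exists (c *: y + z); [exact: SD|exact: mul_linear].
have [x [Ix x0]] : exists x, I x /\ x <> 0.
  apply: contrapT => /forallNP nI; apply: Ine; apply/seteqP; split=> [x Ix|_ ->//].
  by apply: contrapT => x0; apply: (nI x).
apply: (dim_ge_of_dual_systems (vsep x (IS x Ix) x0)) => // t k.
exact: Imul.
Qed.

End RightIdeals.

Section ArensLinear.
Variables (R : realType) (A : banachAlgType R).

Lemma luc_arens_linear (Phi : dual (LUC A)) : linear (luc_arens Phi).
Proof.
move=> c Psi Psi'; apply: dualP => S; rewrite dualD dualZ.
rewrite -[RHS]/(c *: Phi (luc_dual_act_LUC Psi S) + Phi (luc_dual_act_LUC Psi' S)).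
by rewrite -linearP; congr (Phi _); exact/val_inj/dualP.
Qed.

Lemma bidual_arens_linear (Phi : dual (dual A)) : linear (bidual_arens Phi).
Proof.
move=> c Psi Psi'; apply: dualP => S; rewrite dualD dualZ.
rewrite -[RHS]/(c *: Phi (bidual_act Psi S) + Phi (bidual_act Psi' S)).
by rewrite -linearP; congr (Phi _); exact: dualP.
Qed.

(** By construction of LUC(A) the [T . a] span a dense subspace; approximations found in the dual of
    [A] have to be lifted to the subtype [LUC A]. *)
Lemma luc_dual_nonzero (Phi : dual (LUC A)) : Phi <> 0 ->
  exists T a, Phi (luc_act T a) <> 0.
Proof.
move=> Phi0; apply: contrapT => nT; apply: Phi0.
pose gen := [set luc_act T a | T in [set: dual A] & a in [set: A]].
apply: (@dual_eq0_dense _ _ gen); last first.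
  by move=> _ [T _ [a _ <-]]; apply: contrapT => Ta; apply: nT; exists T, a.
apply/seteqP; split=> // S _; apply/closure_normP => eps e0.
have /closure_normP/(_ _ e0)[S0 S0gen SS0] := @luc_inP _ _ S.
exists (mk_luc (subset_closure S0gen)) => //.
move: S0gen (subset_closure S0gen) => [n [c [v [vgen S0E]]]] S0L.
have /choice[w wP] : forall i, exists w : LUC A, gen w /\ lucval w = v i.
  move=> i; have [T _ [a _ <-]] := vgen i; exists (luc_act T a).
  by split=> //; exists T => //; exists a.
exists n, c, w; split=> [i|]; first exact: (wP i).1.
apply: val_inj; rewrite /= S0E.
rewrite (big_morph (fun S : LUC A => lucval S) (id1 := 0) (op1 := +%R))//.
by apply: eq_bigr => i _; rewrite lucZ (wP i).2.
Qed.

End ArensLinear.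

(** * Dual systems built from cluster points *)

Section Main.
Variables (R : realType) (A : banachAlgType R).
Variables (J : Type) (leJ : J -> J -> Prop) (e : J -> A).
Hypothesis he : bounded_approximate_identity leJ e.
Variables (d : Order.disp_t) (eta : orderType d) (m : nat) (m0 : (0 < m)%N).
Variables (Aa : eta -> set A) (a : eta -> 'I_m -> A -> A) (base : Fl1_base Aa a).
Variables (T : Type) (P : T -> set_system eta).
Hypotheses (Pinj : injective P) (Pcof : forall t, cofinal_ultrafilters eta (P t)).

Let Psi t k := cluster_point leJ e a (P t) k.

(** [F i] interpolates the indicator of a set [U i] that belongs to [P (q i)] and to no other
    [P (q j)]. *)
Lemma cluster_points_dual_system n (q : 'I_n -> T) (S : dual A) : injective q ->
  exists F : 'I_n -> 'I_m -> dual A, forall i j,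
    \sum_(k < m) luc_dual_act (Psi (q j) k) (F i k) = if i == j then S else 0.
Proof.
move=> qinj.
have [i|U UP] := @separating_ultrafilter_sets _ n (P \o q) _ (inj_comp Pinj qinj).
  exact: (Pcof (q i)).1.
have /choice[F FP] := fun i => Fl1_base_interpolation S (U i) base.
exists F => i j; rewrite (cluster_point_act he base m0 (Pcof (q j)) (FP i)).
by case: asboolP => [/(UP i j) ->|nU]; [rewrite eqxx|case: eqP => // /(UP i j)].
Qed.

(** The functionals are evaluations at [F i k . b], which lies in LUC(A) while [F i k] need not.
    Since [<Phi Psi, F . b> = <Phi, (Psi . F) . b>], summing over [k] gives [Phi (S . b)] or [0],
    whence the normalising factor. *)
Lemma luc_dual_systems (Phi : dual (LUC A)) : Phi <> 0 ->
  has_dual_systems (fun t k => luc_arens Phi (Psi t k)).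
Proof.
move=> /luc_dual_nonzero[S [b Sb]] n q qinj.
have [F FP] := cluster_points_dual_system S qinj.
exists (fun i k (Z : dual (LUC A)) => (Phi (luc_act S b))^-1 *: Z (luc_act (F i k) b)).
split=> [i k c Z Z'|i j].
  by rewrite dualD dualZ scalerDr !scalerA [_^-1 * c]mulrC.
rewrite -scaler_sumr.
have -> : \sum_(k < m) luc_arens Phi (Psi (q j) k) (luc_act (F i k) b) =
    Phi (luc_act (\sum_(k < m) luc_dual_act (Psi (q j) k) (F i k)) b).
  have lact : linear (fun U : dual A => luc_act U b).
    by move=> c U U'; exact/val_inj/dualP.
  rewrite (linear_sum_fun _ _ lact) (linear_sum_fun _ _ (dual_linear Phi)).
  apply: eq_bigr => k _; congr (Phi _); apply/val_inj/dualP => x /=.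
  congr (Psi _ _ _); apply/val_inj/dualP => y /=.
  by rewrite bmulA.
rewrite FP; case: eqP => _.
  by rewrite -[LHS]/(_ * _) mulVf//; exact/eqP.
rewrite (_ : luc_act 0 b = 0); last exact/val_inj/dualP.
by rewrite (linear_zero (dual_linear Phi)) scaler0.
Qed.

(** In the bidual, evaluation at [F i k] itself is available. The action of an extension on [F i k]
    is computed from its values at the elements [F i k . x] of LUC(A), where it agrees with the
    cluster point. *)
Lemma bidual_dual_systems (ext : dual (LUC A) -> dual (dual A)) (Phi : dual (dual A)) :
  (forall t k (S : LUC A), ext (Psi t k) S = Psi t k S) -> Phi <> 0 ->
  has_dual_systems (fun t k => bidual_arens Phi (ext (Psi t k))).
Proof.
move=> extE Phi0 n q qinj.
have [S PS] : exists S, Phi S <> 0.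
  by apply: contrapT => /forallNP nS; apply: Phi0; apply: dualP => S; exact: contrapT.
have [F FP] := cluster_points_dual_system S qinj.
exists (fun i k (Z : dual (dual A)) => (Phi S)^-1 *: Z (F i k)).
split=> [i k c Z Z'|i j].
  by rewrite dualD dualZ scalerDr !scalerA [_^-1 * c]mulrC.
rewrite -scaler_sumr.
have -> : \sum_(k < m) bidual_arens Phi (ext (Psi (q j) k)) (F i k) =
    Phi (\sum_(k < m) luc_dual_act (Psi (q j) k) (F i k)).
  rewrite (linear_sum_fun _ _ (dual_linear Phi)).
  apply: eq_bigr => k _; congr (Phi _); apply: dualP => x /=.
  exact: (extE (q j) k (luc_act (F i k) x)).
rewrite FP; case: eqP => _; first by rewrite -[LHS]/(_ * _) mulVf//; exact/eqP.
by rewrite (linear_zero (dual_linear Phi)) scaler0.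
Qed.

End Main.

Lemma infinite_double_powerset (T : Type) : infinite_set [set: T] ->
  infinite_set [set: set (set T)].
Proof.
move=> /infiniteP/card_leTP[h hinj _]; apply/infiniteP/card_leTP.
exists (fun i => [set [set h i]]) => // i j.
move=> hij; apply: hinj.
have hij1 : [set h i] = [set h j] by have : [set [set h j]] [set h i] by rewrite -hij.
by have : [set h j] (h i) by rewrite -hij1.
Qed.

Local Close Scope complex_scope.

Theorem theorem5p2 (R : realType) (A : banachAlgType R)
  (J : Type) (leJ : J -> J -> Prop) (e : J -> A)
  (he : bounded_approximate_identity leJ e)
  (d : Order.disp_t) (eta : orderType d) (heta : infinite_initial_ordinal eta)
  (m : nat) (hm : (0 < m)%N)
  (Aa : eta -> set A) (a : eta -> 'I_m -> A -> A) (hL : Fl1_base Aa a)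
  (ext : dual (LUC A) -> dual (dual A))
  (hext : forall Psi, cluster_points leJ e a Psi ->
    norm_preserving_extension Psi (ext Psi)) :
  (forall S : set (dual (LUC A)),
     subalgebra (@luc_arens R A) S -> S <> [set 0] ->
     cluster_points leJ e a `<=` S ->
     right_ideals_dim_ge (@luc_arens R A) S (set (set eta))) /\
  (forall S : set (dual (dual A)),
     subalgebra (@bidual_arens R A) S -> S <> [set 0] ->
     ext @` cluster_points leJ e a `<=` S ->
     right_ideals_dim_ge (@bidual_arens R A) S (set (set eta))).
Proof.
(* The type [set (set eta)], of cardinality [2 ^ 2 ^ eta], indexes distinct cofinal ultrafilters and
   hence the dual systems. *)
have [P Pinj Pcof] := many_cofinal_ultrafilters heta.
have Tinf : infinite_set [set: set (set eta)].
  by case: heta => _ etainf _; exact: infinite_double_powerset.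
have cluster t k : cluster_points leJ e a (cluster_point leJ e a (P t) k).
  by exists k => //; exists (P t).
split=> S Salg _ XS.
  apply: (right_ideals_dim_ge_of_dual_systems (@luc_arens_linear R A) Salg
    (v := fun t k => cluster_point leJ e a (P t) k) _ Tinf) => [t k|Phi _].
    exact: XS (cluster t k).
  exact: (luc_dual_systems he hm hL Pinj Pcof).
apply: (right_ideals_dim_ge_of_dual_systems (@bidual_arens_linear R A) Salg
  (v := fun t k => ext (cluster_point leJ e a (P t) k)) _ Tinf) => [t k|Phi _].
  by apply: XS; exists (cluster_point leJ e a (P t) k).
apply: (bidual_dual_systems he hm hL Pinj Pcof) => t k U.
exact: (hext _ (cluster t k)).1.
Qed.
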